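(* Let $(\mathbb{P}^m,P)$ be a completely monotone positive geometry. Then its algebraic boundary $\partial_a P$ (the Zariski closure in $\mathbb{P}^m$ of the Euclidean boundary of $P$) is cut out by a hyperbolic polynomial with hyperbolicity region equal to $P$.
   Context: **Projective conventions.** $\mathbb{P}^m$ and $\mathbb{P}^m_{\mathbb{R}}$ are complex and real projective space, and $\pi:\mathbb{R}^{m+1}\setminus\{0\}\to\mathbb{P}^m_{\mathbb{R}}$ is the projection; $\mathbb{P}(K)=\pi(K\setminus\{0\})$. A semialgebraic cone is a finite boolean combination of subsets of $\mathbb{R}^{m+1}$ defined by homogeneous polynomial equations and inequalities; a semialgebraic set in $\mathbb{P}^m_{\mathbb{R}}$ is the image of a semialgebraic cone under $\pi$. A subset $P\subset\mathbb{P}^m_{\mathbb{R}}$ is convex if $P=\mathbb{P}(K)$ for a convex set $K\subset\mathbb{R}^{m+1}\setminus\{0\}$, and very compact if it is disjoint from some real hyperplane. If $P$ is very compact, $\pi^{-1}(P)=\widehat P\cup(-\widehat P)$ for a pointed cone $\widehat P$ (pointed: containing no line), unique up to sign, called the cone over $P$; if $P$ is open, connected and convex, then $\widehat P$ is an open convex cone. **Positive geometry.** Let $X$ be an $m$-dimensional irreducible complex projective variety defined over $\mathbb{R}$, and $P\subset X(\mathbb{R})$ an $m$-dimensional, very compact, open, oriented semialgebraic subset. The algebraic boundary $\partial_aP$ is the Zariski closure in $X$ of the Euclidean boundary of $P$; its irreducible components are prime divisors $\mathcal{D}_1,\dots,\mathcal{D}_r$. Let $D_i$ be the relative interior in $\mathcal{D}_i(\mathbb{R})$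 of $\mathcal{D}_i\cap\overline P$ ($\overline P$ the Euclidean closure), with the induced orientation. $(X,P)$ is a positive geometry if there is a unique meromorphic $m$-form $\mathbf{\Omega}_P$ on $X$ (the canonical form) such that: if $m>0$, $\mathbf{\Omega}_P$ has poles only along $\mathcal{D}_1,\dots,\mathcal{D}_r$, the pole along each $\mathcal{D}_i$ is simple, and the Poincaré residue $\mathrm{Res}_{\mathcal{D}_i}\mathbf{\Omega}_P$ is the canonical form of the positive geometry $(\mathcal{D}_i,D_i)$ (recursively); if $m=0$, $P$ is a point and $\mathbf{\Omega}_P=\pm1$, the sign being the orientation. **Canonical function.** For $X=\mathbb{P}^m$ one can write $\mathbf{\Omega}_P=\frac{q(x)}{p(x)}\,dx$ with $p,q\in\mathbb{R}[x_1,\dots,x_{m+1}]$ coprime homogeneous polynomials, $\deg p=\deg q+m+1$ (in the chart $x_{m+1}=1$, $dx=dx_1\cdots dx_m$). The rational function $\Omega_{\widehat P}=q/p$, viewed on $\widehat P$, is the canonical function. **Complete monotonicity.** A smooth function $f:C\to\mathbb{R}$ on an open convex cone $C\subset\mathbb{R}^n$ is completely monotone if $(-1)^r D_{v_1}\cdots D_{v_r}f(x)\ge 0$ for all $r\ge0$, $v_1,\dots,v_r\in C$, $x\in C$, where $D_v$ is the directional derivative. A convex positive geometry $(\mathbb{P}^m,P)$ is completely monotone if $\Omega_{\widehat P}$ is (defined and) completely monotone on $\widehat P$, up to an overall choice of sign. **Hyperbolicity.** A homogeneous $p\in\mathbb{R}[x_1,\dots,x_n]$ is hyperbolic with respect to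 $e\in\mathbb{R}^n$ if $p(e)>0$ and for every $x\in\mathbb{R}^n$ the univariate polynomial $t\mapsto p(te+x)$ has only real zeros. The connected component $C$ of $\{x\in\mathbb{R}^n: p(x)\ne0\}$ containing $e$ is the hyperbolicity cone (an open convex cone), and $\mathbb{P}(C)\subset\mathbb{P}^{n-1}_{\mathbb{R}}$ is the corresponding hyperbolicity region. *)

(* Defs.v *)
From HB Require Import structures.
From mathcomp Require Import all_boot all_order all_algebra.
From mathcomp Require Import all_classical all_reals all_analysis.
From mathcomp Require Import complex.
(* the notations of mpoly clash with those of mathcomp-analysis *)
From mathcomp Require Import -(notations) mpoly.

Set Implicit Arguments.
Unset Strict Implicit.
Unset Printing Implicit Defensive.

Import Order.TTheory GRing.Theory Num.Theory.
Import numFieldNormedType.Exports.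

Local Open Scope classical_set_scope.
Local Open Scope ring_scope.

(* A subset of P^(n-1) (real or complex) is represented by its preimage in the
   space 'rV_n of homogeneous coordinates: a set of nonzero vectors stable under
   nonzero scalars.  For real sets the quotient topology of projective space is
   then the topology induced by 'rV[R]_n on the nonzero vectors. *)

(** * Homogeneous polynomials *)

Definition evalp (K : comNzRingType) (n : nat) (p : mpoly n K)
  (z : 'rV[K]_n) : K := meval (fun i => z 0 i) p.

Definition diffp (K : comNzRingType) (n : nat) (p : mpoly n K)
  (z v : 'rV[K]_n) : K := \sum_(i < n) evalp (mderiv i p) z * v 0 i.

Definition homog (K : comNzRingType) (n d : nat) (p : mpoly n K) : Prop :=
  p \is ishomog1 d mdeg.

Definition coprimep_mpoly (K : fieldType) (n : nat) (p q : mpoly n K) :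
  Prop :=
  forall d a b : mpoly n K, p = a * d -> q = b * d -> d \is a GRing.unit.

Definition complexp (R : realType) (n : nat) (p : mpoly n R) :
  mpoly n R[i] := map_mpoly (real_complex R) p.

Definition toC (R : realType) (m n : nat) (x : 'M[R]_(m, n)) : 'M[R[i]]_(m, n) :=
  map_mx (real_complex R) x.

(** * Complex projective varieties *)

Definition projective_space (R : realType) (n : nat) : set 'rV[R[i]]_n :=
  [set z | z != 0].

Definition zariski_closure (R : realType) (n : nat) (A : set 'rV[R[i]]_n) :
  set 'rV[R[i]]_n :=
  [set z | z != 0 /\ forall (d : nat) (p : mpoly n R[i]), homog d p ->
             (forall a, A a -> evalp p a = 0) -> evalp p z = 0].

Definition zariski_closed (R : realType) (n : nat) (X : set 'rV[R[i]]_n) :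
  Prop := zariski_closure X = X.

Definition irreducible_variety (R : realType) (n : nat) (X : set 'rV[R[i]]_n) :
  Prop :=
  [/\ X !=set0, zariski_closed X &
      forall Y Z, zariski_closed Y -> zariski_closed Z ->
        X = Y `|` Z -> X = Y \/ X = Z].

Definition irreducible_component (R : realType) (n : nat)
  (X D : set 'rV[R[i]]_n) : Prop :=
  [/\ irreducible_variety D, D `<=` X &
      forall E, irreducible_variety E -> D `<=` E -> E `<=` X -> E = D].

(* irreducible of codimension one in X *)
Definition prime_divisor (R : realType) (n : nat) (X D : set 'rV[R[i]]_n) :
  Prop :=
  [/\ irreducible_variety D, D `<` X &
      forall E, irreducible_variety E -> D `<=` E -> E `<=` X ->
        E = D \/ E = X].

Definition irreducible_chain (R : realType) (n : nat) (X : set 'rV[R[i]]_n)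
  (k : nat) : Prop :=
  exists Z : nat -> set 'rV[R[i]]_n,
    (forall i, (i <= k)%N -> irreducible_variety (Z i) /\ Z i `<=` X) /\
    (forall i, (i < k)%N -> Z i `<` Z i.+1).

Definition has_dim (R : realType) (n : nat) (X : set 'rV[R[i]]_n) (m : nat) :
  Prop := irreducible_chain X m /\ ~ irreducible_chain X m.+1.

Definition defined_over_reals (R : realType) (n : nat) (X : set 'rV[R[i]]_n) :
  Prop :=
  forall z, z != 0 ->
    (forall (d : nat) (p : mpoly n R), homog d p ->
       (forall x, X x -> evalp (complexp p) x = 0) ->
       evalp (complexp p) z = 0) ->
    X z.

Definition real_points (R : realType) (n : nat) (X : set 'rV[R[i]]_n) :
  set 'rV[R]_n := [set x | x != 0 /\ X (toC x)].

(* tangent space at z of the affine cone over X; the tangent space of X itself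
   at the point z is its quotient by the line spanned by z *)
Definition tangent (R : realType) (n : nat) (X : set 'rV[R[i]]_n)
  (z v : 'rV[R[i]]_n) : Prop :=
  forall (d : nat) (p : mpoly n R[i]), homog d p ->
    (forall a, X a -> evalp p a = 0) -> diffp p z v = 0.

(* nonsingular points of an m-dimensional X: the cone has dimension m.+1 *)
Definition regular_point (R : realType) (n m : nat) (X : set 'rV[R[i]]_n)
  (z : 'rV[R[i]]_n) : Prop :=
  X z /\ exists B : 'M[R[i]]_(m.+1, n),
    row_free B /\ forall v, tangent X z v <-> (v <= B)%MS.

(** * Meromorphic differential forms *)

Record ratfun (R : realType) (n : nat) :=
  RatFun { rnum : mpoly n R[i]; rden : mpoly n R[i] }.

(* For irreducible Z this says that f belongs to the local ring O_(X,Z) of any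
   variety X containing Z, and, for Z = X, to the function field of X. *)
Definition is_ratfun (R : realType) (n : nat) (Z : set 'rV[R[i]]_n)
  (f : ratfun R n) : Prop :=
  (exists d, homog d (rnum f) /\ homog d (rden f)) /\
  (exists z, Z z /\ evalp (rden f) z != 0).

Definition def_at (R : realType) (n : nat) (z : 'rV[R[i]]_n) (f : ratfun R n) :
  Prop := evalp (rden f) z != 0.

Definition reval (R : realType) (n : nat) (f : ratfun R n) (z : 'rV[R[i]]_n) :
  R[i] := evalp (rnum f) z / evalp (rden f) z.

Definition rdiff (R : realType) (n : nat) (f : ratfun R n)
  (z v : 'rV[R[i]]_n) : R[i] :=
  (diffp (rnum f) z v * evalp (rden f) z
   - evalp (rnum f) z * diffp (rden f) z v) / evalp (rden f) z ^+ 2.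

Definition rmul (R : realType) (n : nat) (f g : ratfun R n) : ratfun R n :=
  RatFun (rnum f * rnum g) (rden f * rden g).

(* f is integral over O_(X,Z), i.e. regular on the normalization of X at the
   generic points of the preimage of Z *)
Definition integral_along (R : realType) (n : nat) (X Z : set 'rV[R[i]]_n)
  (f : ratfun R n) : Prop :=
  is_ratfun X f /\
  exists (k : nat) (c : 'I_k -> ratfun R n),
    (forall i, is_ratfun Z (c i)) /\
    (forall z, X z -> def_at z f -> (forall i, def_at z (c i)) ->
       reval f z ^+ k + \sum_(i < k) reval (c i) z * reval f z ^+ i = 0).

(* the m-form  \sum_k coef_k d(arg_k0) /\ ... /\ d(arg_k(m-1)) *)
Record mform (R : realType) (n m : nat) := MForm {
  nterms : nat;
  coef : 'I_nterms -> ratfun R n;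
  arg : 'I_nterms -> 'I_m -> ratfun R n }.
Arguments coef {R n m} _ _.
Arguments arg {R n m} _ _ _.

Definition form_all (R : realType) (n m : nat) (Q : ratfun R n -> Prop)
  (w : mform R n m) : Prop :=
  (forall k, Q (coef w k)) /\ (forall k j, Q (arg w k j)).

(* value at z on the tangent vectors given by the rows of V *)
Definition form_eval (R : realType) (n m : nat) (w : mform R n m)
  (z : 'rV[R[i]]_n) (V : 'M[R[i]]_(m, n)) : R[i] :=
  \sum_(k < nterms w) reval (coef w k) z *
    \det (\matrix_(i < m, j < m) rdiff (arg w k j) z (row i V)).

Definition form_scale (R : realType) (n m : nat) (g : ratfun R n)
  (w : mform R n m) : mform R n m :=
  MForm (fun k => rmul g (coef w k)) (arg w).

Definition meromorphic (R : realType) (n m : nat) (X : set 'rV[R[i]]_n)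
  (w : mform R n m) : Prop := form_all (is_ratfun X) w.

(* equality of meromorphic m-forms on the irreducible m-dimensional X *)
Definition eq_form (R : realType) (n m : nat) (X : set 'rV[R[i]]_n)
  (w w' : mform R n m) : Prop :=
  forall z V, regular_point m X z ->
    form_all (def_at z) w -> form_all (def_at z) w' ->
    (forall i, tangent X z (row i V)) -> form_eval w z V = form_eval w' z V.

(* w has no pole along the prime divisor Z of X; when X is singular along Z,
   poles are taken on the normalization *)
Definition regular_along (R : realType) (n m : nat) (X Z : set 'rV[R[i]]_n)
  (w : mform R n m) : Prop :=
  exists w' : mform R n m, form_all (integral_along X Z) w' /\ eq_form X w w'.

(* X is generically nonsingular along D, so that O_(X,D) is a discrete valuation
   ring, and g generates its maximal ideal *)
Definition uniformizer (R : realType) (n m : nat) (X D : set 'rV[R[i]]_n)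
  (g : ratfun R n) : Prop :=
  [/\ is_ratfun D g, (forall z, D z -> evalp (rnum g) z = 0) &
      exists z v, [/\ D z, regular_point m X z, def_at z g, tangent X z v &
                      rdiff g z v != 0]].

Definition simple_pole (R : realType) (n m : nat) (X D : set 'rV[R[i]]_n)
  (w : mform R n m) : Prop :=
  ~ regular_along X D w /\
  exists g, uniformizer m X D g /\ regular_along X D (form_scale g w).

(* If w = dg/g /\ eta' + eta'' with eta', eta'' regular along D, then g w is
   equal on D to dg /\ eta', whose value on (u, v_1, ..., v_m) with v_i tangent
   to D is dg(u) eta'(v_1, ..., v_m). *)
Definition poincare_residue (R : realType) (n m : nat) (X D : set 'rV[R[i]]_n)
  (w : mform R n m.+1) (eta : mform R n m) : Prop :=
  meromorphic D eta /\
  exists g (w1 : mform R n m.+1),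
    [/\ uniformizer m.+1 X D g, form_all (is_ratfun D) w1,
        eq_form X (form_scale g w) w1 &
        forall z u (V : 'M[R[i]]_(m, n)),
          regular_point m.+1 X z -> regular_point m D z ->
          def_at z g -> form_all (def_at z) w1 -> form_all (def_at z) eta ->
          tangent X z u -> (forall i, tangent D z (row i V)) ->
          form_eval w1 z (col_mx u V) = rdiff g z u * form_eval eta z V].

(** * Real sets *)

Definition proj_image (R : realType) (n : nat) (K : set 'rV[R]_n) :
  set 'rV[R]_n :=
  [set x | exists (c : R) (y : 'rV[R]_n),
     [/\ c != 0, K y, y != 0 & x = c *: y]].

Inductive semialgebraic_cone (R : realType) (n : nat) : set 'rV[R]_n -> Prop :=
| Semialg_eq (d : nat) (p : mpoly n R) :
    homog d p -> semialgebraic_cone [set x | evalp p x = 0]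
| Semialg_gt (d : nat) (p : mpoly n R) :
    homog d p -> semialgebraic_cone [set x | 0 < evalp p x]
| Semialg_compl (A : set 'rV[R]_n) :
    semialgebraic_cone A -> semialgebraic_cone (~` A)
| Semialg_inter (A B : set 'rV[R]_n) :
    semialgebraic_cone A -> semialgebraic_cone B ->
    semialgebraic_cone (A `&` B).

Definition semialgebraic (R : realType) (n : nat) (P : set 'rV[R]_n) : Prop :=
  exists K, semialgebraic_cone K /\ P = proj_image K.

Definition very_compact (R : realType) (n : nat) (P : set 'rV[R]_n) : Prop :=
  exists l : 'cV[R]_n, l != 0 /\ forall x, P x -> (x *m l) 0 0 != 0.

Definition convex_proj (R : realType) (n : nat) (P : set 'rV[R]_n) : Prop :=
  exists K : set 'rV[R]_n, [/\ convex_set K, ~ K 0 & P = proj_image K].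

Definition open_in (R : realType) (n : nat) (A P : set 'rV[R]_n) : Prop :=
  exists U, open U /\ P = U `&` A.

Definition euclidean_boundary (R : realType) (n : nat) (X : set 'rV[R[i]]_n)
  (P : set 'rV[R]_n) : set 'rV[R]_n :=
  real_points X `&` (closure P `&` closure (real_points X `\` P)).

Definition algebraic_boundary (R : realType) (n : nat) (X : set 'rV[R[i]]_n)
  (P : set 'rV[R]_n) : set 'rV[R[i]]_n :=
  zariski_closure (@toC R 1 n @` euclidean_boundary X P).

(* relative interior in D(R) of D(R) `&` closure P *)
Definition facet (R : realType) (n : nat) (D : set 'rV[R[i]]_n)
  (P : set 'rV[R]_n) : set 'rV[R]_n :=
  [set x | real_points D x /\
           nbhs x [set y | real_points D y -> closure P y]].

(** * Orientations *)

(* the rows of V represent a basis of the tangent space of X(R) at x *)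
Definition tangent_frame (R : realType) (n m : nat) (X : set 'rV[R[i]]_n)
  (x : 'rV[R]_n) (V : 'M[R]_(m, n)) : Prop :=
  (forall i, tangent X (toC x) (toC (row i V))) /\ row_free (col_mx x V).

(* An orientation tells which frames are positive.  The tangent vector of
   projective space represented by v at x is represented by c *: v at c *: x. *)
Definition orientation (R : realType) (n m : nat) :=
  'rV[R]_n -> 'M[R]_(m, n) -> bool.

Definition is_orientation (R : realType) (n m : nat) (X : set 'rV[R[i]]_n)
  (P : set 'rV[R]_n) (o : orientation R n m) : Prop :=
  forall x V, P x -> regular_point m X (toC x) -> tangent_frame X x V ->
    [/\ forall (A : 'M[R]_m) (c : 'cV[R]_m), A \in unitmx ->
          o x (A *m V + c *m x) = if 0 < \det A then o x V else ~~ o x V,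
        forall c : R, c != 0 -> o (c *: x) (c *: V) = o x V &
        nbhs (x, V) [set yW | P yW.1 -> regular_point m X (toC yW.1) ->
                       tangent_frame X yW.1 yW.2 -> o yW.1 yW.2 = o x V]].

(* near x, the set P lies strictly on the negative side of the smooth
   hypersurface D(R) = {g = 0} of X(R) *)
Definition one_sided (R : realType) (n : nat) (X D : set 'rV[R[i]]_n)
  (P : set 'rV[R]_n) (x : 'rV[R]_n) (g : mpoly n R) : Prop :=
  [/\ exists d, homog d g,
      forall z, D z -> evalp (complexp g) z = 0,
      exists u, tangent X (toC x) (toC u) /\ diffp g x u != 0 &
      nbhs x [set y | P y -> evalp g y < 0]].

(* Boundary orientation, outward normal first.  The opposite convention would
   only multiply canonical forms in dimension m by (-1)^m. *)
Definition induced_orientation (R : realType) (n m : nat)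
  (X D : set 'rV[R[i]]_n) (P : set 'rV[R]_n) (o : orientation R n m.+1)
  (o' : orientation R n m) : Prop :=
  let S := [set x | [/\ facet D P x, regular_point m.+1 X (toC x),
                        regular_point m D (toC x) &
                        exists g, one_sided X D P x g]] in
  [/\ is_orientation D (facet D P) o', facet D P `<=` closure S &
      forall x g u (V : 'M[R]_(m, n)), S x -> one_sided X D P x g ->
        tangent_frame D x V -> tangent X (toC x) (toC u) -> 0 < diffp g x u ->
        nbhs (x, col_mx u V : 'M[R]_(m.+1, n))
          [set yW | P yW.1 -> regular_point m.+1 X (toC yW.1) ->
             tangent_frame X yW.1 yW.2 -> o yW.1 yW.2 = o' x V]].

(** * Positive geometries *)

Definition oriented_region (R : realType) (n m : nat) (X : set 'rV[R[i]]_n)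
  (P : set 'rV[R]_n) (o : orientation R n m) : Prop :=
  [/\ [/\ irreducible_variety X, has_dim X m & defined_over_reals X],
      [/\ P `<=` real_points X, open_in (real_points X) P, semialgebraic P &
          (* dimension of P as a semialgebraic set *)
          has_dim (zariski_closure (@toC R 1 n @` P)) m],
      very_compact P, is_orientation X P o &
      forall D, irreducible_component (algebraic_boundary X P) D ->
        prime_divisor X D].

Definition unique_form (R : realType) (n m : nat) (X : set 'rV[R[i]]_n)
  (spec : mform R n m -> Prop) (w : mform R n m) : Prop :=
  [/\ meromorphic X w, spec w &
      forall w', meromorphic X w' -> spec w' -> eq_form X w w'].

(* (X, P) with the orientation o is a positive geometry, with canonical form w *)
Fixpoint canonical_form (R : realType) (n m : nat) :
  set 'rV[R[i]]_n -> set 'rV[R]_n -> orientation R n m -> mform R n m -> Prop :=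
  match m with
  | 0 => fun X P o w =>
      oriented_region X P o /\
      unique_form X (fun w => forall x, P x ->
        form_eval w (toC x) 0 = if o x 0 then 1 else -1) w
  | m'.+1 => fun X P o w =>
      oriented_region X P o /\
      unique_form X (fun w =>
        (forall Z, prime_divisor X Z ->
           ~ irreducible_component (algebraic_boundary X P) Z ->
           regular_along X Z w) /\
        (forall D, irreducible_component (algebraic_boundary X P) D ->
           simple_pole X D w /\
           exists (o' : orientation R n m') (eta : mform R n m'),
             [/\ induced_orientation X D P o o', poincare_residue X D w eta &
                 canonical_form D (facet D P) o' eta])) w
  end.

Definition positive_geometry (R : realType) (n m : nat) (X : set 'rV[R[i]]_n)
  (P : set 'rV[R]_n) (o : orientation R n m) : Prop :=
  exists w, canonical_form X P o w.

(** * Complete monotonicity *)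

(* w = (q/p) dx on P^m, with dx = dx_1 ... dx_m in the chart x_(m+1) = 1.  The
   homogeneous expression of dx is the determinant with rows v_1, ..., v_m, z;
   the sign moves z to the first row. *)
Definition canonical_fraction (R : realType) (m : nat) (w : mform R m.+1 m)
  (q p : mpoly m.+1 R) : Prop :=
  [/\ exists d, homog d q /\ homog (d + m.+1)%N p, p != 0, coprimep_mpoly p q &
      forall z (V : 'M[R[i]]_(m, m.+1)),
        evalp (complexp p) z != 0 -> form_all (def_at z) w ->
        form_eval w z V =
          evalp (complexp q) z / evalp (complexp p) z *
          ((-1) ^+ m * \det (col_mx z V : 'M[R[i]]_m.+1))].

(* the cone over P, up to sign *)
Definition cone_over (R : realType) (n : nat) (P C : set 'rV[R]_n) : Prop :=
  [/\ forall (t : R) x, 0 < t -> C x -> C (t *: x),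
      forall x, ~ (C x /\ C (- x)) &
      P = C `|` [set x | C (- x)]].

Definition open_convex_cone (R : realType) (m : nat) (C : set 'rV[R]_m.+1) :
  Prop :=
  [/\ open C, convex_set C & forall (t : R) x, 0 < t -> C x -> C (t *: x)].

Fixpoint iter_derive (R : realType) (m : nat) (vs : seq 'rV[R]_m.+1)
  (f : 'rV[R]_m.+1 -> R) : 'rV[R]_m.+1 -> R :=
  match vs with
  | [::] => f
  | v :: vs' => fun x => 'D_v (iter_derive vs' f) x
  end.

Definition smooth_on (R : realType) (m : nat) (C : set 'rV[R]_m.+1)
  (f : 'rV[R]_m.+1 -> R) : Prop :=
  forall (vs : seq 'rV[R]_m.+1) x, C x -> differentiable (iter_derive vs f) x.

Definition completely_monotone (R : realType) (m : nat) (C : set 'rV[R]_m.+1)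
  (f : 'rV[R]_m.+1 -> R) : Prop :=
  [/\ open_convex_cone C, smooth_on C f &
      forall (vs : seq 'rV[R]_m.+1) x, (forall v, v \in vs -> C v) -> C x ->
        0 <= (-1) ^+ size vs * iter_derive vs f x].

Definition completely_monotone_geometry (R : realType) (m : nat)
  (P : set 'rV[R]_m.+1) (o : orientation R m.+1 m) : Prop :=
  convex_proj P /\
  exists (w : mform R m.+1 m) (q p : mpoly m.+1 R) (C : set 'rV[R]_m.+1),
    [/\ canonical_form (@projective_space R m.+1) P o w,
        canonical_fraction w q p, cone_over P C,
        forall x, C x -> evalp p x != 0 &
        completely_monotone C (fun x => evalp q x / evalp p x) \/
        completely_monotone C (fun x => - (evalp q x / evalp p x))].

(** * Hyperbolicity *)

Definition hyperbolic (R : realType) (n : nat) (p : mpoly n R)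
  (e : 'rV[R]_n) : Prop :=
  [/\ exists d, homog d p, 0 < evalp p e &
      forall (x : 'rV[R]_n) (t : R[i]),
        evalp (complexp p) (t *: toC e + toC x) = 0 -> complex.Im t = 0].

Definition hyperbolicity_cone (R : realType) (n : nat) (p : mpoly n R)
  (e : 'rV[R]_n) : set 'rV[R]_n :=
  connected_component [set x | evalp p x != 0] e.

Definition hyperbolicity_region (R : realType) (n : nat) (p : mpoly n R)
  (e : 'rV[R]_n) : set 'rV[R]_n := proj_image (hyperbolicity_cone p e).

Definition zero_locus (R : realType) (n : nat) (p : mpoly n R) :
  set 'rV[R[i]]_n := [set z | z != 0 /\ evalp (complexp p) z = 0].

(* Main.v *)
(** Let [q / p] be the canonical function on the cone [C] over [P].  Its Taylor
    coefficients in directions of [- C] are nonnegative, hence its Taylor series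
    at a suitable point of [C] in a complex direction is dominated by one in a
    real direction, and converges at any prescribed point of the tube
    [C + i R^n]; so a zero of [p] in the tube is a zero of [q].  Since [p] and
    [q] are coprime, a Bezout identity along a line and the continuity of roots
    exclude such zeros, which is hyperbolicity of [p].  The denominator [p]
    vanishes on the boundary of [P]: otherwise the canonical form would be
    regular along a component of the algebraic boundary, where it has a pole.
    Finally, by Gauss' lemma, a divisor of [p] of least degree vanishing on the
    boundary of [C] divides every polynomial that vanishes there; it is
    hyperbolic as a divisor of [p], and its complex zeros are the Zariski
    closure of the boundary. *)

Require Import Defs.
From HB Require Import structures.
From mathcomp Require Import all_boot all_order all_algebra.
From mathcomp Require Import all_classical all_reals all_analysis.
From mathcomp Require Import complex ring lra zify.
From mathcomp Require Import -(notations) mpoly.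

Set Implicit Arguments.
Unset Strict Implicit.
Unset Printing Implicit Defensive.
Import Order.TTheory GRing.Theory Num.Theory.
Import numFieldNormedType.Exports.
Local Open Scope classical_set_scope.
Local Open Scope ring_scope.

Local Notation "c %:MP" := (mpolyC _ c) (at level 1, format "c %:MP").
Local Notation "''X_' i" := (mpolyX _ (mnm1 i)) (at level 8, i at level 2).

(** * Unique factorization in polynomial rings *)

(** Coprime polynomials may share zeros in codimension two, so one common zero of [p] and [q] in the
    tube is no contradiction. The contradiction is that every zero of [p] there is shared: zeros of
    [p] persist when the line carrying them is moved slightly, whereas on lines of a fixed direction
    common zeros occur only if the base point is a zero of a fixed nonzero polynomial [s]. The base
    point is moved off [s = 0]; the direction [u] lies in [C], where [p(u) != 0] keeps the degree of
    [p] on the line constant, so no root escapes to infinity. The same elimination works at real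
    points: the lines parallel to [e] near a boundary point of [C] cross the boundary, which makes
    all polynomials vanishing there multiples of a single one. Elimination with coefficients in a
    polynomial ring rests on Gauss' lemma, hence on unique factorization. The Taylor series is never
    summed: geometric bounds on its coefficients are fed into a finite rearrangement. *)

Definition divides (A : comNzRingType) (a b : A) : Prop := exists c, b = c * a.

Definition prime_elt (A : comUnitRingType) (a : A) : Prop :=
  [/\ a != 0, a \isn't a GRing.unit &
      forall b c, divides a (b * c) -> divides a b \/ divides a c].

(** Factors are prime rather than irreducible, which makes uniqueness automatic. *)
Definition factorial_ring (A : comUnitRingType) : Prop :=
  forall a : A, a != 0 -> exists (u : A) (s : seq A),
    [/\ u \is a GRing.unit, forall x, x \in s -> prime_elt x &
        a = u * \prod_(x <- s) x].

Section Divides.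
Variable A : comNzRingType.
Implicit Types a b c : A.

Lemma divides_refl a : divides a a. Proof. by exists 1; rewrite mul1r. Qed.

Lemma divides_trans b a c : divides a b -> divides b c -> divides a c.
Proof. by case=> x -> [y ->]; exists (y * x); rewrite mulrA. Qed.

Lemma divides_mull a b c : divides a b -> divides a (c * b).
Proof. by case=> x ->; exists (c * x); rewrite mulrA. Qed.

Lemma divides_mulr a b c : divides a b -> divides a (b * c).
Proof. by move=> ?; rewrite mulrC; apply: divides_mull. Qed.

Lemma dividesD a b c : divides a b -> divides a c -> divides a (b + c).
Proof. by case=> x -> [y ->]; exists (x + y); rewrite mulrDl. Qed.

Lemma dividesB a b c : divides a b -> divides a c -> divides a (b - c).
Proof. by case=> x -> [y ->]; exists (x - y); rewrite mulrBl. Qed.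

Lemma divides0 a : divides a 0. Proof. by exists 0; rewrite mul0r. Qed.

End Divides.

Lemma prime_ndivides_unit (A : comUnitRingType) (x u : A) :
  prime_elt x -> u \is a GRing.unit -> ~ divides x u.
Proof.
case=> _ + _ => /negP xN uU [c uE]; apply: xN.
by move: uU; rewrite uE unitrM => /andP[].
Qed.

Lemma prime_divides_prime (A : idomainType) (x y : A) :
  prime_elt x -> prime_elt y -> divides x y -> divides y x.
Proof.
move=> px [y0 _ yP] [c yE].
have [[d cE]|//] : divides y c \/ divides y x by apply: yP; rewrite -yE; exact: divides_refl.
case: (prime_ndivides_unit px (unitr1 A)); exists d.
apply: (mulIf y0); rewrite mul1r {1}yE cE -!mulrA; congr (_ * _).
by rewrite mulrC.
Qed.

Section Gauss.
Variable A : idomainType.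
Implicit Types (x : A) (f g : {poly A}).

Lemma divides_polyC_lead x f :
  divides x%:P f -> divides x (lead_coef f).
Proof. by case=> g ->; exists (lead_coef g); rewrite lead_coefM lead_coefC. Qed.

Lemma divides_polyC_drop_lead x f : divides x (lead_coef f) ->
  divides x%:P (lead_coef f *: 'X^((size f).-1)).
Proof.
case=> c ->; exists (c *: 'X^((size f).-1)).
by rewrite [RHS]mulrC mul_polyC scalerA [_ * c]mulrC.
Qed.

Lemma size_drop_lead f : f != 0 ->
  (size (f - lead_coef f *: 'X^((size f).-1))%R < size f)%N.
Proof.
move=> f0; have sf : (0 < size f)%N by rewrite size_poly_gt0.
rewrite -[ltnRHS](prednK sf) ltnS; apply/leq_sizeP => j.
rewrite leq_eqVlt => /predU1P[<-|lj].
  by rewrite coefB coefZ coefXn eqxx mulr1 subrr.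
rewrite coefB coefZ coefXn (gtn_eqF lj) mulr0 subr0 nth_default //.
by rewrite -(prednK sf).
Qed.

(** [x] divides the product of the leading coefficients, hence one of them; removing that leading
    term lowers the size and keeps the divisibility. *)
Lemma prime_polyC x : prime_elt x -> prime_elt x%:P.
Proof.
move=> px; have [x0 xU xP] := px; split=> [||f g].
- by rewrite polyC_eq0.
- by rewrite poly_unitE size_polyC x0 coefC.
have [n] := ubnP (size f + size g)%N; elim: n f g => // n IHn f g lefg xfg.
have [->|f0] := eqVneq f 0; first by left; apply: divides0.
have [->|g0] := eqVneq g 0; first by right; apply: divides0.
have := divides_polyC_lead xfg; rewrite lead_coefM => /xP[] /divides_polyC_drop_lead dl.
- have [] := IHn (f - lead_coef f *: 'X^((size f).-1)) g.
  + by rewrite -ltnS (leq_trans _ lefg) // ltnS ltn_add2r size_drop_lead.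
  + by rewrite mulrBl; apply: dividesB => //; apply: divides_mulr.
  + by move=> df; left; rewrite -(subrK (lead_coef f *: 'X^((size f).-1)) f); apply: dividesD.
  + by right.
- have [] := IHn f (g - lead_coef g *: 'X^((size g).-1)).
  + by rewrite -ltnS (leq_trans _ lefg) // ltnS ltn_add2l size_drop_lead.
  + by rewrite mulrBr; apply: dividesB => //; apply: divides_mull.
  + by left.
  + by move=> df; right; rewrite -(subrK (lead_coef g *: 'X^((size g).-1)) g); apply: dividesD.
Qed.

Definition primitive f : Prop := forall x, prime_elt x -> ~ divides x%:P f.

Hypothesis facA : factorial_ring A.

Lemma primitive_part f : f != 0 ->
  exists c g, [/\ c != 0, primitive g & f = c *: g].
Proof.
move=> f0; have lf0 : lead_coef f != 0 by rewrite lead_coef_eq0.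
have [u [s [uU sP lfE]]] := facA lf0.
(* Invariant: the leading coefficient is [a] times the primes still to be tried, and no prime
   divisor of [a] divides [f]. A tried prime that divides [f] is cancelled; otherwise it joins [a].
   At the end a prime constant dividing [f] would divide [lead_coef f = a]. *)
suff: forall s a f, f != 0 -> lead_coef f = a * \prod_(x <- s) x ->
    (forall x, x \in s -> prime_elt x) ->
    (forall x, prime_elt x -> divides x a -> ~ divides x%:P f) ->
    exists c g, [/\ c != 0, primitive g & f = c *: g].
  move=> /(_ s u f f0 lfE sP); apply=> x px.
  by move=> /(prime_ndivides_unit px uU).
elim=> [|x s' IHs] a h h0.
  rewrite big_nil mulr1 => <- _ aP; exists 1, h; split; rewrite ?oner_eq0 ?scale1r //.
  by move=> x px xh; apply: (aP x px) => //; apply: divides_polyC_lead.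
rewrite big_cons => lh sP' aP.
have px : prime_elt x by apply: sP'; rewrite mem_head.
have s'P y : y \in s' -> prime_elt y by move=> ys; apply: sP'; rewrite inE ys orbT.
have [[k hE]|xh] := pselect (divides x%:P h).
  have k0 : k != 0 by apply: contraNneq h0 => k0; rewrite hE k0 mul0r.
  have [||c [g [c0 gP kE]]] := IHs a k k0 _ s'P.
  - have [x0 _ _] := px; apply: (mulIf x0).
    have <- : lead_coef h = lead_coef k * x by rewrite hE lead_coefM lead_coefC.
    by rewrite lh -mulrA [x * _]mulrC.
  - by move=> y py ya [l kE]; apply: (aP y py ya); exists (l * x%:P); rewrite hE kE mulrAC.
  exists (x * c), g; split=> //; first by have [x0 _ _] := px; rewrite mulf_neq0.
  by rewrite hE kE [LHS]mulrC mul_polyC scalerA.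
apply: (IHs (a * x) h h0) => //; first by rewrite lh mulrA.
move=> y py yax yh; have [_ _ /(_ _ _ yax)[ya|yx]] := py; first exact: (aP y py ya).
apply: xh; apply: divides_trans yh; have [c ->] := prime_divides_prime py px yx.
by exists c%:P; rewrite polyCM.
Qed.

(** The primes of [c] are cancelled one at a time: each stays prime in [{poly A}] and does not
    divide [f], so it divides the cofactor. *)
Lemma primitive_divides f g c : primitive f -> c != 0 ->
  divides f (c *: g) -> divides f g.
Proof.
move=> fP c0; have [u [s [uU sP ->]]] := facA c0.
elim: s g sP => [|x s IHs] g sP; rewrite ?big_nil ?big_cons.
  rewrite mulr1 => -[k kE]; exists (u^-1 *: k).
  by rewrite -scalerAl -kE scalerA mulVr // scale1r.
rewrite mulrCA -scalerA -mul_polyC => -[k kE].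
have px : prime_elt x by apply: sP; rewrite mem_head.
have [x0 _ xP] := prime_polyC px.
have [|[l lE]|/(fP _ px)//] := xP k f.
  by rewrite -kE; apply: divides_mulr; apply: divides_refl.
apply: IHs => [y ys|]; first by apply: sP; rewrite inE ys orbT.
by exists l; apply: (mulfI x0); rewrite kE lE mulrCA mulrA.
Qed.

(** Gauss' lemma: over a domain, [%|] is divisibility up to a nonzero constant, that is, over the
    fraction field; primitivity brings it back to [A]. *)
Lemma primitive_dvdp f g : primitive f -> f %| g -> divides f g.
Proof.
move=> fP /Pdiv.Idomain.dvdpP[[c q] /= c0 cE].
by apply: (primitive_divides fP c0); exists q.
Qed.

Lemma primitive_dvdp_part f : f != 0 ->
  exists g, [/\ primitive g, size g = size f & g %= f].
Proof.
move=> f0; have [c [g [c0 gP fE]]] := primitive_part f0.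
exists g; split=> //; first by rewrite fE size_scale.
by rewrite fE eqp_sym eqp_scale.
Qed.

Lemma primitive_divisor f g : primitive f -> divides g f -> primitive g.
Proof. by move=> fP gf x px xg; apply: (fP x px); apply: divides_trans gf. Qed.

(** The gcd with [f] shows that [g] is coprime to [f] or divisible by it over the fraction field;
    [primitive_dvdp] brings either outcome back to [A]. *)
Lemma primitive_prime f : primitive f -> (1 < size f)%N ->
  (forall g, g %| f -> size g = 1 \/ size g = size f) -> prime_elt f.
Proof.
move=> fP sf fI; have f0 : f != 0 by rewrite -size_poly_gt0 ltnW.
split=> //; first by rewrite poly_unitE; case: eqP => // sf1; rewrite sf1 in sf.
move=> g h fgh; have [sd|sd] := fI _ (dvdp_gcdl f g).
  right; apply: primitive_dvdp => //.
  rewrite -(@Gauss_dvdpr _ h g f) /coprimep ?sd //.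
  by case: fgh => k ->; apply: dvdp_mull.
left; apply: primitive_dvdp => //.
apply: dvdp_trans (dvdp_gcdr f g).
by move/eqP: sd; rewrite (dvdp_size_eqp (dvdp_gcdl f g)) eqp_sym => /andP[].
Qed.

Lemma factorial_poly : factorial_ring {poly A}.
Proof.
move=> f f0; have [c [g [c0 gP fE]]] := primitive_part f0.
have [u [s [uU sP cE]]] := facA c0.
suff [v [r [vU rP gE]]] : exists (v : {poly A}) (r : seq {poly A}), [/\ v \is a GRing.unit,
    forall h, h \in r -> prime_elt h & g = v * \prod_(h <- r) h].
  exists (u%:P * v), ([seq x%:P | x <- s] ++ r); split.
  - have u0 : u != 0 by apply: contraTneq uU => ->; rewrite unitr0.
    by rewrite unitrM vU andbT poly_unitE size_polyC u0 coefC.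
  - by move=> x; rewrite mem_cat => /orP[/mapP[y ys ->]|/rP //]; apply/prime_polyC/sP.
  - rewrite fE cE big_cat /= big_map -mul_polyC polyCM rmorph_prod /= gE.
    by rewrite mulrACA.
have {f f0 fE} g0 : g != 0 by apply: contraNneq f0 => g0; rewrite fE g0 scaler0.
have [n] := ubnP (size g); elim: n g g0 gP => // n IHn g g0 gP sg.
have [sg1|sg1] := leqP (size g) 1.
  (* A primitive constant is a unit, since a prime factor of it would divide it. *)
  have gC := size1_polyC sg1; have g00 : g`_0 != 0 by rewrite -polyC_eq0 -gC.
  have [v [r [vU rP gE]]] := facA g00.
  exists g, [::]; split=> //; last by rewrite big_nil mulr1.
  case: r rP gE => [|x r] rP gE.
    rewrite big_nil mulr1 in gE; rewrite poly_unitE gE vU andbT.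
    by rewrite eqn_leq sg1 size_poly_gt0.
  case: (gP x (rP _ (mem_head _ _))); exists (v * \prod_(x <- r) x)%:P.
  by rewrite -polyCM {1}gC gE big_cons [x * _]mulrC mulrA.
have [gI|] := pselect (forall h, h %| g -> size h = 1 \/ size h = size g).
  exists 1, [:: g]; split; rewrite ?unitr1 ?big_seq1 ?mul1r // => x.
  by rewrite inE => /eqP ->; apply: primitive_prime.
move=> /existsNP[h /not_implyP[hg /not_orP[sh1 shg]]].
have h0 : h != 0 by apply: contraNneq g0 => h0; move: hg; rewrite h0 dvd0p.
(* The factor over the fraction field is replaced by its primitive part, which divides [g] over [A];
   the cofactor is again primitive, and both are shorter than [g]. *)
have [k [kP sk kh]] := primitive_dvdp_part h0.
have [l gE] : divides k g by apply: primitive_dvdp; rewrite // (eqp_dvdl _ kh).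
have k0 : k != 0 by rewrite -size_poly_eq0 sk size_poly_eq0.
have l0 : l != 0 by apply: contraNneq g0 => l0; rewrite gE l0 mul0r.
have sE : size g = (size l + size k).-1 by rewrite gE size_mul.
have [sl0 sk0] : (0 < size l /\ 0 < size k)%N by rewrite !size_poly_gt0.
have sh1' : size h != 1%N by apply/eqP.
have shg' : size h != size g by apply/eqP.
have skg : (size k < size g)%N by rewrite sk ltn_neqAle shg' dvdp_leq.
have sk1 : (1 < size k)%N by rewrite sk ltn_neqAle eq_sym sh1' size_poly_gt0.
have slg : (size l < size g)%N by rewrite sE -subn1 -addnBA ?subn1 // -ltn_subLR ?subnn // -ltnS prednK.
have [v1 [r1 [v1U r1P kE]]] := IHn k k0 kP (leq_trans skg sg).
have lP : primitive l by apply: primitive_divisor gP _; exists k; rewrite mulrC.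
have [v2 [r2 [v2U r2P lE]]] := IHn l l0 lP (leq_trans slg sg).
exists (v2 * v1), (r2 ++ r1); split; first by rewrite unitrM v2U.
  by move=> x; rewrite mem_cat => /orP[/r2P|/r1P].
by rewrite big_cat gE lE kE mulrACA.
Qed.

(* The gcd over the fraction field, made primitive, is a gcd over [A]. *)
Lemma poly_bezout f g : f != 0 -> exists d u v s,
  [/\ s != 0, divides d f, divides d g & s%:P * d = u * f + v * g].
Proof.
move=> f0; have d00 : gcdp f g != 0 by rewrite gcdp_eq0 (negPf f0).
have [d [dP sd dd]] := primitive_dvdp_part d00.
have [[u v] /= /Pdiv.Idomain.eqpP[[a b] /= /andP[a0 b0] uvE]] := Pdiv.Idomain.Bezoutp f g.
have /Pdiv.Idomain.eqpP[[a' b'] /= /andP[a'0 b'0] dE] := dd.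
exists d, ((b' * a) *: u), ((b' * a) *: v), (b * a').
split; rewrite ?mulf_neq0 //.
- by apply: primitive_dvdp => //; rewrite (eqp_dvdl _ dd) dvdp_gcdl.
- by apply: primitive_dvdp => //; rewrite (eqp_dvdl _ dd) dvdp_gcdr.
- rewrite mul_polyC -!scalerAl -scalerDr -[b' * a *: _]scalerA uvE -scalerA dE.
  by rewrite !scalerA mulrC.
Qed.
End Gauss.

Lemma factorial_ring_iso (A B : comUnitRingType) (f : {rmorphism A -> B})
  (g : {rmorphism B -> A}) :
  cancel f g -> cancel g f -> factorial_ring A -> factorial_ring B.
Proof.
move=> fK gK facA b b0.
have fU x : (f x \is a GRing.unit) = (x \is a GRing.unit).
  by apply/idP/idP => [/(rmorph_unit g)|/(rmorph_unit f)//]; rewrite fK.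
have fd x y : divides (f x) y <-> divides x (g y).
  split=> [[c ->]|[c gE]]; first by exists (g c); rewrite rmorphM fK.
  by exists (f c); rewrite -rmorphM -gE gK.
have [|u [s [uU sP bE]]] := facA (g b).
  by apply: contraNneq b0 => gb0; rewrite -(gK b) gb0 rmorph0.
exists (f u), (map f s); split; rewrite ?fU //; last first.
  by rewrite big_map -rmorph_prod -rmorphM -bE gK.
move=> _ /mapP[x xs ->]; have [x0 xU xP] := sP x xs; split.
- by apply: contraNneq x0 => fx0; rewrite -(fK x) fx0 rmorph0.
- by rewrite fU.
- by move=> c d /fd; rewrite rmorphM => /xP[] /fd; [left|right].
Qed.

Lemma mpoly_rmorph_ext (n : nat) (K : nzRingType) (S : comNzRingType)
  (f g : {rmorphism mpoly n K -> S}) :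
  (forall c, f c%:MP = g c%:MP) -> (forall i, f 'X_i = g 'X_i) -> f =1 g.
Proof.
move=> fgC fgX p; rewrite (mpolyE p) !raddf_sum; apply: eq_bigr => m _.
rewrite -mul_mpolyC /= !rmorphM /= fgC; congr (_ * _).
rewrite mpolyXE_id !rmorph_prod /=; apply: eq_bigr => i _.
by rewrite !rmorphXn /= fgX.
Qed.

Lemma poly_rmorph_ext (A B : comNzRingType) (f g : {rmorphism {poly A} -> B}) :
  (forall c, f c%:P = g c%:P) -> f 'X = g 'X -> f =1 g.
Proof.
move=> fgC fgX p; rewrite -(coefK p) poly_def !raddf_sum; apply: eq_bigr => i _.
by rewrite -mul_polyC /= !rmorphM /= fgC !rmorphXn /= fgX.
Qed.

Lemma mmapXU (n : nat) (K : nzRingType) (S : comNzRingType)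
  (f : {rmorphism K -> S}) (h : 'I_n -> S) (i : 'I_n) : mmap f h 'X_i = h i.
Proof. by rewrite mmapX mmap1U. Qed.

Section MpolyFactorial.
Variable K : fieldType.

Lemma factorial_mpoly (n : nat) : factorial_ring (mpoly n K).
Proof.
elim: n => [|n IHn].
  move=> p p0; exists p, [::]; split=> //; last by rewrite big_nil mulr1.
  rewrite (nvar0_mpolyC p) rmorph_unit // unitfE.
  by apply: contraNneq p0 => p00; rewrite (nvar0_mpolyC p) p00 mpolyC0.
have [F [FC FX]] : exists F : {rmorphism mpoly n.+1 K -> {poly mpoly n K}},
    (forall c, F c%:MP = (c%:MP)%:P) /\
    (forall i, F 'X_i = if unlift ord_max i is Some j then ('X_j)%:P else 'X).
  exists (mmap (polyC \o @mpolyC n K)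
    (fun i => if unlift ord_max i is Some j then ('X_j)%:P else 'X)).
  by split=> [c|i] /=; [rewrite mmapC | rewrite mmapXU].
have [G [GC GX]] : exists G : {rmorphism {poly mpoly n K} -> mpoly n.+1 K},
    (forall p, G p%:P = mmap (@mpolyC n.+1 K) (fun j => 'X_(lift ord_max j)) p) /\
    G 'X = 'X_(ord_max : 'I_n.+1).
  exists (horner_eval ('X_(ord_max : 'I_n.+1) : mpoly n.+1 K) \o
    map_poly (mmap (@mpolyC n.+1 K) (fun j => 'X_(lift ord_max j)))).
  by split=> [p|] /=; rewrite /horner_eval ?map_polyC ?map_polyX ?hornerC ?hornerX.
apply: (@factorial_ring_iso _ _ G F); last exact: factorial_poly.
- apply: (@poly_rmorph_ext _ _ (F \o G) idfun) => [c|] /=.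
    rewrite GC; apply: (@mpoly_rmorph_ext _ _ _ (F \o _) polyC) => [a|i] /=.
      by rewrite mmapC FC.
    by rewrite mmapXU FX liftK.
  by rewrite GX FX unlift_none.
- apply: (@mpoly_rmorph_ext _ _ _ (G \o F) idfun) => [c|i] /=.
    by rewrite FC GC mmapC.
  rewrite FX; case: unliftP => [j ->|->]; last by rewrite GX.
  by rewrite GC mmapXU.
Qed.

End MpolyFactorial.

(* [mshift e p] is the polynomial [p (x + t e)], [t] being the new variable. *)
Definition mshift (K : comNzRingType) (n : nat) (e : 'rV[K]_n) :
    mpoly n K -> {poly mpoly n K} :=
  mmap (polyC \o @mpolyC n K) (fun i => ('X_i)%:P + (e 0 i)%:MP *: 'X).

HB.instance Definition _ (K : comNzRingType) (n : nat) (e : 'rV[K]_n) :=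
  GRing.RMorphism.copy (mshift e)
    (mmap (polyC \o @mpolyC n K) (fun i => ('X_i)%:P + (e 0 i)%:MP *: 'X)).

Lemma mshiftC (K : comNzRingType) (n : nat) (e : 'rV[K]_n) c :
  mshift e c%:MP = (c%:MP)%:P.
Proof. by rewrite /mshift mmapC. Qed.

Lemma mshiftXU (K : comNzRingType) (n : nat) (e : 'rV[K]_n) i :
  mshift e 'X_i = ('X_i)%:P + (e 0 i)%:MP *: 'X.
Proof. by rewrite /mshift mmapXU. Qed.

Lemma mshift_inj (K : comNzRingType) (n : nat) (e : 'rV[K]_n) :
  injective (mshift e).
Proof.
suff mK r : (mshift e r).[0] = r by move=> p q pq; rewrite -(mK p) pq mK.
apply: (@mpoly_rmorph_ext _ _ _ (horner_eval 0 \o mshift e) idfun) => [c|i] /=.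
  by rewrite /horner_eval mshiftC hornerC.
by rewrite /horner_eval mshiftXU !hornerE ?mulr0 ?addr0.
Qed.

(* Undoing the shift turns [d] into a divisor of the polynomial [p], which is
   constant in [t]; so the result is constant in [t] as well. *)
Lemma mshift_divides (K : fieldType) (n : nat) (e : 'rV[K]_n) (p : mpoly n K)
  (d : {poly mpoly n K}) :
  p != 0 -> divides d (mshift e p) -> exists2 r, d = mshift e r & divides r p.
Proof.
move=> p0 [c pE].
have [T [TC TX]] : exists T : 'rV[K]_n ->
    {rmorphism {poly mpoly n K} -> {poly mpoly n K}},
    (forall v q, T v q%:P = mshift v q) /\ (forall v, T v 'X = 'X).
  exists (fun v => horner_eval 'X \o map_poly (mshift v)).
  by split=> [v q|v] /=; rewrite /horner_eval ?map_polyC ?map_polyX ?hornerC ?hornerX.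
have TN v q : T v (mshift (- v) q) = q%:P.
  apply: (@mpoly_rmorph_ext _ _ _ (T v \o mshift (- v)) polyC) => [a|i] /=.
    by rewrite mshiftC TC mshiftC.
  rewrite mshiftXU -mul_polyC rmorphD rmorphM /= !TC TX mshiftXU mshiftC mxE.
  by rewrite -mul_polyC -addrA -mulrDl -polyCD -mpolyCD addrN mpolyC0 mul0r addr0.
have TK f : T e (T (- e) f) = f.
  apply: (@poly_rmorph_ext _ _ (T e \o T (- e)) idfun) => [a|] /=.
    by rewrite TC TN.
  by rewrite !TX.
have pE' : p%:P = T (- e) c * T (- e) d.
  by rewrite -rmorphM -pE -{2}(opprK e) TN.
have /andP[c0 d0] : (T (- e) c != 0) && (T (- e) d != 0).
  by rewrite -negb_or -mulf_eq0 -pE' polyC_eq0.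
have /eqP : size (T (- e) c * T (- e) d) = 1%N by rewrite -pE' size_polyC p0.
rewrite size_mul_eq1 => /andP[/eqP sc /eqP sd].
exists (T (- e) d)`_0.
  by rewrite -TC -size1_polyC ?sd // TK.
exists (T (- e) c)`_0; apply: polyC_inj.
by rewrite polyCM -!size1_polyC ?sd ?sc.
Qed.

(** The coefficient map [phi] lets one identity over the base field be used at complex points
    ([real_complex R]) and at real ones ([idfun]). *)
Definition evalm (K L : comNzRingType) (phi : {rmorphism K -> L}) (n : nat)
  (z : 'rV[L]_n) : mpoly n K -> L := mmap phi (fun i => z 0 i).

HB.instance Definition _ (K L : comNzRingType) (phi : {rmorphism K -> L})
  (n : nat) (z : 'rV[L]_n) :=
  GRing.RMorphism.copy (evalm phi z) (mmap phi (fun i => z 0 i)).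

Lemma evalmC (K L : comNzRingType) (phi : {rmorphism K -> L}) (n : nat)
  (z : 'rV[L]_n) c : evalm phi z c%:MP = phi c.
Proof. by rewrite /evalm mmapC. Qed.

Lemma evalmXU (K L : comNzRingType) (phi : {rmorphism K -> L}) (n : nat)
  (z : 'rV[L]_n) i : evalm phi z 'X_i = z 0 i.
Proof. by rewrite /evalm mmapXU. Qed.

Lemma horner_mshift (K L : comNzRingType) (phi : {rmorphism K -> L}) (n : nat)
  (e : 'rV[K]_n) (z : 'rV[L]_n) t p :
  (map_poly (evalm phi z) (mshift e p)).[t] =
  evalm phi (z + t *: map_mx phi e) p.
Proof.
apply: (@mpoly_rmorph_ext _ _ _ (horner_eval t \o map_poly (evalm phi z) \o mshift e)) => [c|i] /=.
  by rewrite /horner_eval mshiftC map_polyC hornerC /= !evalmC.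
rewrite /horner_eval mshiftXU -mul_polyC rmorphD rmorphM /= map_polyX !map_polyC /=.
by rewrite !evalmC !evalmXU !hornerE !mxE mulrC.
Qed.

(** [d] comes from a gcd in [t] of [p(x + t e)] and [g(x + t e)], which is itself a shift because it
    divides one. The multiplier [s] depends on [x] only, so one base point [z] with [s(z) != 0]
    serves for all [t] at once. *)
Lemma mpoly_bezout (K : fieldType) (n : nat) (e : 'rV[K]_n) (p g : mpoly n K) :
  p != 0 -> exists d s, [/\ s != 0, divides d p, divides d g &
    forall (L : idomainType) (phi : {rmorphism K -> L}) (z : 'rV[L]_n) (t : L),
      evalm phi (z + t *: map_mx phi e) p = 0 ->
      evalm phi (z + t *: map_mx phi e) g = 0 ->
      evalm phi z s = 0 \/ evalm phi (z + t *: map_mx phi e) d = 0].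
Proof.
move=> p0.
have mp0 : mshift e p != 0.
  by rewrite -(rmorph0 (mshift e)) (inj_eq (@mshift_inj _ _ e)).
have [D [u [v [s [s0 Dp Dg sE]]]]] := poly_bezout (@factorial_mpoly K n) (mshift e g) mp0.
have [d dE dp] := mshift_divides p0 Dp.
have dg : divides d g.
  have [->|g0] := eqVneq g 0; first exact: divides0.
  have [d' dE' dg'] := mshift_divides g0 Dg.
  suff -> : d = d' by [].
  exact: (@mshift_inj _ _ e _ _ (etrans (esym dE) dE')).
exists d, s; split=> // L phi z t pz gz.
suff /eqP : evalm phi z s * evalm phi (z + t *: map_mx phi e) d = 0.
  by rewrite mulf_eq0 => /orP[] /eqP; [left|right].
have [E [EM EC]] : exists E : {rmorphism {poly mpoly n K} -> L},
    (forall q, E (mshift e q) = evalm phi (z + t *: map_mx phi e) q) /\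
    (forall q, E q%:P = evalm phi z q).
  exists (horner_eval t \o map_poly (evalm phi z)); split=> q.
    exact: horner_mshift.
  by rewrite /= /horner_eval map_polyC hornerC.
have sE' : E (s%:P * D) = E (u * mshift e p) + E (v * mshift e g).
  by rewrite sE; exact: rmorphD.
have EP q w : evalm phi (z + t *: map_mx phi e) q = 0 -> E (w * mshift e q) = 0.
  by move=> q0; rewrite (rmorphM E w (mshift e q)) [X in _ * X]EM q0 mulr0.
have E1 := rmorphM E s%:P D.
apply: etrans (_ : E (s%:P * D) = 0); last first.
  apply: etrans sE' _.
  by apply: etrans (congr2 +%R (EP p u pz) (EP g v gz)) (addr0 _).
apply: etrans (esym E1); apply: (congr2 *%R); first by rewrite EC.
by apply: etrans (esym (EM d)) _; congr (E _).
Qed.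

(** * Factors of homogeneous polynomials *)

Lemma poly_monomial_factor (A : idomainType) (f g : {poly A}) (c : A) (d : nat) :
  c != 0 -> f * g = c *: 'X^d -> exists b k, f = b *: 'X^k.
Proof.
move=> c0; elim: d f g => [|d IHd] f g fgE.
  have : size (f * g) = 1%N by rewrite fgE expr0 alg_polyC size_polyC c0.
  move=> /eqP; rewrite size_mul_eq1 => /andP[/eqP sf _].
  by exists f`_0, 0; rewrite expr0 alg_polyC -size1_polyC ?sf.
have X0 : ('X : {poly A}) != 0 by rewrite polyX_eq0.
have := congr1 (fun h : {poly A} => h.[0]) fgE.
rewrite hornerM hornerZ hornerXn expr0n mulr0 => /eqP.
rewrite mulf_eq0 => /orP[] /factor_theorem[q]; rewrite subr0 => qE.
  have [|b [k q2]] := IHd q g; last first.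
    by exists b, k.+1; rewrite qE q2 -scalerAl -exprSr.
  by apply: (mulIf X0); rewrite mulrAC -qE fgE -scalerAl -exprSr.
by apply: (IHd f q); apply: (mulIf X0); rewrite -mulrA -qE fgE -scalerAl -exprSr.
Qed.

(** The substitution of [T x] for [x], [T] being the new variable; its coefficients in [T] are the
    homogeneous components. *)
Definition mhomogenize (K : comNzRingType) (n : nat) :
    mpoly n K -> {poly mpoly n K} :=
  mmap (polyC \o @mpolyC n K) (fun i => 'X_i *: 'X).

HB.instance Definition _ (K : comNzRingType) (n : nat) :=
  GRing.RMorphism.copy (@mhomogenize K n)
    (mmap (polyC \o @mpolyC n K) (fun i => 'X_i *: 'X)).

Lemma coef_mhomogenize (K : comNzRingType) (n : nat) (p : mpoly n K) k :
  (mhomogenize p)`_k = pihomog mdeg k p.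
Proof.
rewrite pihomogE /mhomogenize /mmap coef_sum [RHS]big_mkcond /=.
apply: eq_bigr => m _; rewrite coefCM /mmap1.
rewrite (eq_bigr (fun i => 'X_i ^+ m i *: 'X^(m i))); last by move=> i _; rewrite exprZn.
rewrite scaler_prod -mpolyXE_id prodrXr -mdegE coefZ coefXn eq_sym.
by case: eqP => _; rewrite ?mulr0 ?mulr1 ?mul_mpolyC.
Qed.

Lemma dhomog_mhomogenize (K : comNzRingType) (n d : nat) (p : mpoly n K) :
  p \is ishomog1 d mdeg -> mhomogenize p = p *: 'X^d.
Proof.
move=> pd; apply/polyP => k; rewrite coef_mhomogenize coefZ coefXn.
have [->|kd] := eqVneq k d; first by rewrite mulr1 pihomog_dE.
by rewrite mulr0; apply: pihomog_ne0 pd; rewrite eq_sym.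
Qed.

(** Dilation sends [q] to [q T^d], and a factor of this monomial is a monomial in [T]; so [p] has a
    single homogeneous component. *)
Lemma divides_dhomog (K : idomainType) (n d : nat) (p q : mpoly n K) :
  q != 0 -> q \is ishomog1 d mdeg -> divides p q ->
  exists k, p \is ishomog1 k mdeg.
Proof.
move=> q0 qd [c qE].
have [|b [k pE]] := @poly_monomial_factor _ (mhomogenize p) (mhomogenize c) q d q0.
  by rewrite -(dhomog_mhomogenize qd) qE mulrC rmorphM.
exists k; rewrite (pihomog_partitionE (leqnn (msize p))); apply: rpred_sum => j _.
have [->|jk] := eqVneq (j : nat) k; first exact: pihomogP.
by rewrite -coef_mhomogenize pE coefZ coefXn (negPf jk) mulr0 rpred0.
Qed.

(** * Derivatives of quotients of polynomials *)

Definition mdird (K : comNzRingType) (n : nat) (v : 'rV[K]_n) (p : mpoly n K) :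
  mpoly n K := \sum_(i < n) v 0 i *: mderiv i p.

Section Mdird.
Variables (K : comNzRingType) (n : nat).
Implicit Types (v w : 'rV[K]_n) (p q : mpoly n K).

Lemma mdirdD v p q : mdird v (p + q) = mdird v p + mdird v q.
Proof. by rewrite /mdird -big_split; apply: eq_bigr => i _; rewrite mderivD scalerDr. Qed.

Lemma mdirdZ v a p : mdird v (a *: p) = a *: mdird v p.
Proof.
rewrite /mdird scaler_sumr; apply: eq_bigr => i _.
by rewrite mderivZ !scalerA mulrC.
Qed.

Lemma mdirdM v p q : mdird v (p * q) = mdird v p * q + p * mdird v q.
Proof.
rewrite /mdird mulr_suml mulr_sumr -big_split; apply: eq_bigr => i _.
by rewrite mderivM scalerDr -scalerAl -scalerAr.
Qed.

Lemma mdirdC v a : mdird v a%:MP = 0.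
Proof. by rewrite /mdird big1 // => i _; rewrite mderivC scaler0. Qed.

Lemma mdirdXU v i : mdird v 'X_i = (v 0 i)%:MP.
Proof.
rewrite /mdird (bigD1 i) //= big1 => [|j ji].
  rewrite mderivX mnm1E eqxx scale1r addr0 -mul_mpolyC.
  rewrite (_ : mnm_sub _ _ = mnm0) ?mpolyX0 ?mulr1 //.
  by apply/mnmP => j; rewrite !mnmE subnn.
by rewrite mderivX mnm1E eq_sym (negPf ji) scale0r scaler0.
Qed.

Lemma mdird_lin a b v w p :
  mdird (a *: v + b *: w) p = a *: mdird v p + b *: mdird w p.
Proof.
rewrite /mdird !scaler_sumr -big_split; apply: eq_bigr => i _.
by rewrite !mxE scalerDl !scalerA.
Qed.

End Mdird.

Lemma map_mdird (K L : comNzRingType) (phi : {rmorphism K -> L}) (n : nat)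
  (v : 'rV[K]_n) (p : mpoly n K) :
  map_mpoly phi (mdird v p) = mdird (map_mx phi v) (map_mpoly phi p).
Proof.
rewrite /mdird raddf_sum; apply: eq_bigr => i _ /=.
rewrite map_mpolyZ mxE; congr (_ *: _); apply/mpolyP => m.
by rewrite mcoeff_map_mpoly !mcoeff_mderiv mcoeff_map_mpoly raddfMn.
Qed.

(* The iterated derivative of [g / p ^+ k.+1] in the directions [l] is
   [iter_num p k l g / p ^+ (k + size l).+1]. *)
Fixpoint iter_num (K : comNzRingType) (n : nat) (p : mpoly n K) (k : nat)
    (l : seq 'rV[K]_n) (g : mpoly n K) : mpoly n K :=
  if l is v :: l' then
    let h := iter_num p k l' g in
    p * mdird v h - h * mdird v p *+ (k + size l').+1
  else g.

Section IterNum.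
Variables (K : comNzRingType) (n : nat) (p : mpoly n K).
Implicit Types (v w : 'rV[K]_n) (g h : mpoly n K) (l : seq 'rV[K]_n).

(** This is what the offset [k] is for: the derivatives in [l1] act on a quotient whose denominator
    already has exponent [k + size l2 + 1]. *)
Lemma iter_num_cat l1 l2 k g :
  iter_num p k (l1 ++ l2) g = iter_num p (k + size l2) l1 (iter_num p k l2 g).
Proof. by elim: l1 => //= v l1 ->; rewrite size_cat -addnA [(size l2 + _)%N]addnC. Qed.

Lemma iter_num_lin l k a b g h :
  iter_num p k l (a *: g + b *: h) = a *: iter_num p k l g + b *: iter_num p k l h.
Proof.
elim: l => //= v l ->; rewrite mdirdD !mdirdZ -!mul_mpolyC.
by ring.
Qed.

Lemma iter_num_dir l1 l2 k a b v w g :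
  iter_num p k (l1 ++ (a *: v + b *: w) :: l2) g =
  a *: iter_num p k (l1 ++ v :: l2) g + b *: iter_num p k (l1 ++ w :: l2) g.
Proof.
rewrite !iter_num_cat /= -iter_num_lin; congr (iter_num _ _ _ _).
by rewrite !mdird_lin -!mul_mpolyC; ring.
Qed.
End IterNum.

Lemma map_iter_num (K L : comNzRingType) (phi : {rmorphism K -> L}) (n : nat)
  (p g : mpoly n K) k l :
  map_mpoly phi (iter_num p k l g) =
  iter_num (map_mpoly phi p) k (map (map_mx phi) l) (map_mpoly phi g).
Proof.
elim: l => //= v l <-.
by rewrite raddfB raddfMn /= !rmorphM /= !map_mdird size_map.
Qed.

(** * Taylor coefficients of a quotient in one variable *)

Section QuotientSeries.
Variables (K : fieldType) (P Q : {poly K}).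

(* The [k]-th derivative of [Q / P] is [deriv_num k / P ^+ k.+1]. *)
Fixpoint deriv_num (k : nat) : {poly K} :=
  if k is j.+1 then P * (deriv_num j)^`() - deriv_num j * P^`() *+ j.+1 else Q.

(** The Leibniz rule for [Q = P (Q / P)], multiplied by [P ^+ k.+1] to clear denominators. *)
Lemma deriv_num_leibniz k :
  P ^+ k.+1 * Q^`(k) =
  \sum_(j < k.+1) (P ^+ (k - j) * P^`(k - j) * deriv_num j) *+ 'C(k, j).
Proof.
elim: k => [|k IHk]; first by rewrite big_ord1 expr1 expr0 mul1r !derivn0 bin0.
(* [op f / P ^+ k.+2] is the derivative of [f / P ^+ k.+1]. *)
pose op f : {poly K} := P * f^`() - f * P^`() *+ k.+1.
have opD : {morph op : f g / f + g}.
  by move=> f g; rewrite /op derivD mulrDr mulrDl mulrnDl opprD addrACA.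
have op0 : op 0 = 0 by rewrite /op deriv0 mul0r mulr0 mul0rn subr0.
have opMn f i : op (f *+ i) = op f *+ i.
  elim: i => [|i IHi]; first by rewrite !mulr0n.
  by rewrite !mulrSr opD IHi.
have -> : P ^+ k.+2 * Q^`(k.+1) = op (P ^+ k.+1 * Q^`(k)).
  rewrite derivnS /op derivM deriv_exp /=.
  by rewrite [P ^+ k.+2]exprS [P ^+ k.+1]exprS; ring.
rewrite IHk (big_morph op opD op0).
pose F i j := P ^+ i * P^`(i) * deriv_num j.
(* [op] turns the term of index [j] into those of index [j] and [j + 1]; Pascal's rule recombines
   the binomials. *)
rewrite (eq_bigr (fun j : 'I_k.+1 => F (k.+1 - j)%N j *+ 'C(k, j) + F (k - j)%N j.+1 *+ 'C(k, j))).
  rewrite big_split /= [in RHS]big_ord_recl /= bin0 subn0.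
  rewrite [X in _ = _ + X](eq_bigr (fun j : 'I_k.+1 => F (k - j)%N j.+1 *+ 'C(k, j.+1) + F (k - j)%N j.+1 *+ 'C(k, j))).
    rewrite big_split /= addrA; congr (_ + _).
    transitivity (\sum_(j < k.+2) F (k.+1 - j)%N j *+ 'C(k, j)).
      by rewrite [RHS]big_ord_recr /= bin_small // mulr0n addr0.
    rewrite big_ord_recl /= bin0 subn0.
    by congr (_ + _); apply: eq_bigr => j _; rewrite /bump /= add1n subSS.
  by move=> j _; rewrite /bump /= add1n subSS binS mulrnDr.
move=> [j] /= jk _; rewrite opMn -mulrnDl; congr (_ *+ _).
rewrite /op /F subSn // derivnS !derivM deriv_exp exprS.
have -> : k.+1 = ((k - j) + j.+1)%N by rewrite addnS subnK.
case: (k - j)%N => [|i] /=; last rewrite exprS.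
  by rewrite !mulr0n; ring.
by ring.
Qed.
End QuotientSeries.

Lemma horner_derivn0 (K : nzRingType) (P : {poly K}) k :
  (P^`(k)).[0] = P`_k *+ k`!.
Proof. by rewrite horner_coef0 coef_derivn addn0 ffactnn. Qed.

Definition quotient_coef (K : fieldType) (P Q : {poly K}) (j : nat) : K :=
  (deriv_num P Q j).[0] / (P.[0] ^+ j.+1 * j`!%:R).

(** Comparison of coefficients in [P (Q / P) = Q]: the Leibniz identity at 0, divided by
    [P(0)^(n+1) n!]. *)
Lemma quotient_coefP (K : numFieldType) (P Q : {poly K}) n : P.[0] != 0 ->
  \sum_(j < n.+1) P`_(n - j) * quotient_coef P Q j = Q`_n.
Proof.
move=> P0; have fact0 k : k`!%:R != 0 :> K by rewrite pnatr_eq0 -lt0n fact_gt0.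
have := congr1 (fun f => f.[0]) (deriv_num_leibniz P Q n).
rewrite hornerM horner_derivn0 horner_exp horner_sum -mulr_natr => E.
have PN0 : P.[0] ^+ n.+1 * n`!%:R != 0 by rewrite mulf_neq0 ?expf_neq0.
apply: (mulIf PN0); rewrite [RHS]mulrCA E mulr_suml.
apply: eq_bigr => [[j] /= jn] _; rewrite hornerMn !hornerM horner_exp horner_derivn0.
rewrite /quotient_coef -(bin_fact (jn : (j <= n)%N)) !natrM -[_ *+ (n - j)`!]mulr_natr.
rewrite -[_ *+ 'C(n, j)]mulr_natr.
have -> : P.[0] ^+ n.+1 = P.[0] ^+ (n - j) * P.[0] ^+ j.+1.
  by rewrite -exprD addnS subnK.
have := fact0 j; have := expf_neq0 j.+1 P0.
by move=> A0 B0; field; rewrite A0 B0.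
Qed.

(** Summation by parts in place of convergence: the partial sums of the coefficients of [Q] are
    convolutions of [a] with the partial sums [S] of those of [P]. As [P(1) = 0], [S] vanishes
    beyond the size of [P], so only a bounded number of late terms [a j] contribute, and these decay
    geometrically. *)
Lemma quotient_root1 (K : numFieldType) (P Q : {poly K}) (a : nat -> K) (M th : K) :
  (forall n, \sum_(j < n.+1) P`_(n - j) * a j = Q`_n) ->
  0 <= M -> 0 <= th <= 1 -> (forall eps, 0 < eps -> exists n, th ^+ n < eps) ->
  (forall n, `|a n| <= M * th ^+ n) -> P.[1] = 0 -> Q.[1] = 0.
Proof.
move=> aE M0 /andP[th0 th1] thP aM P1.
pose S m := \sum_(i < m.+1) P`_i.
have SE n : \sum_(i < n.+1) Q`_i = \sum_(j < n.+1) a j * S (n - j)%N.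
  elim: n => [|n IHn].
    by rewrite !big_ord1 /S subnn big_ord1 -aE big_ord1 mulrC.
  rewrite big_ord_recr IHn -aE /= [X in _ + X = _]big_ord_recr [RHS]big_ord_recr /= subnn.
  rewrite [S 0%N]/S big_ord1 addrA -big_split /= [_ * a n.+1]mulrC; congr (_ + _).
  apply: eq_bigr => j _; rewrite /S subSn ?leq_ord // [X in _ = _ * X]big_ord_recr /=.
  by rewrite mulrDr [a j * _]mulrC [a j * P`__]mulrC.
pose s := (size P + size Q)%N; pose B := \sum_(m < s) `|S m|.
have S0 m : (s <= m)%N -> S m = 0.
  move=> sm; rewrite -P1 (@horner_coef_wide _ m.+1); last first.
    by rewrite ltnW // ltnS (leq_trans _ sm) // leq_addr.
  by apply: eq_bigr => i _; rewrite expr1n mulr1.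
have SB m : (m < s)%N -> `|S m| <= B.
  by move=> ms; rewrite /B (bigD1 (Ordinal ms)) //= lerDl sumr_ge0.
have B0 : 0 <= B by apply: sumr_ge0.
have Qk k : `|Q.[1]| <= s%:R * M * B * th ^+ k.
  (* The cutoff [k + s] is past the degree of [Q], so the partial sum is all of [Q(1)]; for [j <= k]
     the index [k + s - j] is at least [s], where [S] vanishes. *)
  have -> : Q.[1] = \sum_(i < (k.+1 + s)) Q`_i.
    rewrite (@horner_coef_wide _ (k.+1 + s)); last first.
      by rewrite (leq_trans (leq_addl (size P) _)) ?leq_addl.
    by apply: eq_bigr => i _; rewrite expr1n mulr1.
  rewrite addSn SE -addSn big_split_ord /= [X in X + _]big1 => [| [j] /= jk _]; last first.
    by rewrite S0 ?mulr0 // -addnBAC // leq_addl.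
  rewrite add0r (le_trans (ler_norm_sum _ _ _)) //.
  have -> : s%:R * M * B * th ^+ k = \sum_(i < s) (M * th ^+ k) * B.
    by rewrite sumr_const card_ord -mulr_natl; ring.
  apply: ler_sum => [[j] /= sj] _; rewrite normrM ler_pM //.
    apply: le_trans (aM _) _; rewrite ler_wpM2l // ler_wiXn2l //.
    by rewrite addSn ltnW // ltnS leq_addr.
  by apply: SB; clearbody s; lia.
apply/eqP; rewrite -normr_le0; apply/contraT => Q1.
have {Q1} Q1 : 0 < `|Q.[1]| by rewrite normr_gt0; apply: contraNneq Q1 => ->; rewrite normr0.
have C0 : 0 <= s%:R * M * B by rewrite !mulr_ge0.
have C1 : 0 < 1 + s%:R * M * B by rewrite ltr_pwDl.
have [k thk] := thP _ (divr_gt0 Q1 C1).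
have : (1 + s%:R * M * B) * th ^+ k < `|Q.[1]|.
  by rewrite -ltr_pdivlMl // mulrC.
rewrite -(ltxx `|Q.[1]|); apply: le_lt_trans; apply: le_trans (Qk k) _.
by rewrite ler_wpM2r ?exprn_ge0 // lerDr.
Qed.

(** * Evaluation, restriction to lines, and multilinear bounds *)

Lemma mpoly_ring_ind (K : comNzRingType) (n : nat) (Q : mpoly n K -> Prop) :
  (forall c, Q c%:MP) -> (forall i, Q 'X_i) ->
  (forall p q, Q p -> Q q -> Q (p + q)) ->
  (forall p q, Q p -> Q q -> Q (p * q)) -> forall p, Q p.
Proof.
move=> QC QX QD QM; elim/mpolyind => [|c m p _ _ Qp]; first by rewrite -mpolyC0.
apply: (QD) => //; rewrite -mul_mpolyC; apply: (QM) => //; rewrite mpolyXE_id.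
apply: (big_ind Q) => [|p1 p2|i _]; [by rewrite -mpolyC1 | exact: QM |].
by elim: (m i) => [|k IHk]; rewrite ?expr0 -?mpolyC1 // exprS; apply: QM.
Qed.

Section Evalp.
Variables (K : comNzRingType) (n : nat) (z : 'rV[K]_n).
Implicit Types p q : mpoly n K.

Lemma evalpD p q : evalp (p + q) z = evalp p z + evalp q z.
Proof. exact: mevalD. Qed.

Lemma evalpN p : evalp (- p) z = - evalp p z.
Proof. exact: mevalN. Qed.

Lemma evalpM p q : evalp (p * q) z = evalp p z * evalp q z.
Proof. exact: mevalM. Qed.

Lemma evalpZ c p : evalp (c *: p) z = c * evalp p z.
Proof. exact: mevalZ. Qed.

Lemma evalpC c : evalp c%:MP z = c.
Proof. exact: mevalC. Qed.

Lemma evalpXU i : evalp 'X_i z = z 0 i.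
Proof. exact: mevalXU. Qed.

End Evalp.

Lemma evalp_map (K L : comNzRingType) (phi : {rmorphism K -> L}) (n : nat)
  (z : 'rV[L]_n) (p : mpoly n K) : evalp (map_mpoly phi p) z = evalm phi z p.
Proof.
elim/mpoly_ring_ind: p => [c|i|p q IHp IHq|p q IHp IHq].
- by rewrite map_mpolyC evalpC evalmC.
- by rewrite map_mpolyX evalpXU evalmXU.
- by rewrite !rmorphD /= evalpD IHp IHq.
- by rewrite !rmorphM /= evalpM IHp IHq.
Qed.

Lemma evalm_map (K L : comNzRingType) (phi : {rmorphism K -> L}) (n : nat)
  (z : 'rV[K]_n) (p : mpoly n K) : evalm phi (map_mx phi z) p = phi (evalp p z).
Proof.
elim/mpoly_ring_ind: p => [c|i|p q IHp IHq|p q IHp IHq].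
- by rewrite evalpC evalmC.
- by rewrite evalpXU evalmXU mxE.
- by rewrite rmorphD evalpD rmorphD /= IHp IHq.
- by rewrite rmorphM evalpM rmorphM /= IHp IHq.
Qed.

Lemma evalp_homog (K : comNzRingType) (n d : nat) (p : mpoly n K) a z :
  homog d p -> evalp p (a *: z) = a ^+ d * evalp p z.
Proof.
move=> /dhomogP pd; rewrite /evalp !mevalE mulr_sumr big_seq [RHS]big_seq.
apply: eq_bigr => m mp; rewrite mulrCA; congr (_ * _).
have <- : mdeg m = d by exact: pd.
rewrite mdegE -prodrXr -big_split; apply: eq_bigr => i _.
by rewrite mxE exprMn.
Qed.

Definition mline (K : comNzRingType) (n : nat) (u v : 'rV[K]_n) :
    mpoly n K -> {poly K} :=
  mmap polyC (fun i => (u 0 i)%:P + (v 0 i) *: 'X).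

HB.instance Definition _ (K : comNzRingType) (n : nat) (u v : 'rV[K]_n) :=
  GRing.RMorphism.copy (mline u v)
    (mmap polyC (fun i => (u 0 i)%:P + (v 0 i) *: 'X)).

Section Mline.
Variables (K : comNzRingType) (n : nat) (u v : 'rV[K]_n).
Implicit Types p q : mpoly n K.

Lemma mlineC c : mline u v c%:MP = c%:P.
Proof. by rewrite /mline mmapC. Qed.

Lemma mlineXU i : mline u v 'X_i = (u 0 i)%:P + v 0 i *: 'X.
Proof. by rewrite /mline mmapXU. Qed.

Lemma horner_mline p t : (mline u v p).[t] = evalp p (u + t *: v).
Proof.
elim/mpoly_ring_ind: p => [c|i|p q IHp IHq|p q IHp IHq].
- by rewrite mlineC hornerC evalpC.
- by rewrite mlineXU !hornerE evalpXU !mxE mulrC.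
- by rewrite rmorphD hornerD evalpD IHp IHq.
- by rewrite rmorphM hornerM evalpM IHp IHq.
Qed.

Lemma deriv_mline p : (mline u v p)^`() = mline u v (mdird v p).
Proof.
elim/mpoly_ring_ind: p => [c|i|p q IHp IHq|p q IHp IHq].
- by rewrite mlineC derivC mdirdC rmorph0.
- by rewrite mlineXU derivD derivC derivZ derivX add0r alg_polyC mdirdXU mlineC.
- by rewrite rmorphD derivD mdirdD rmorphD /= IHp IHq.
- by rewrite rmorphM derivM mdirdM rmorphD !rmorphM /= IHp IHq.
Qed.

End Mline.

Lemma mline_iter_num (K : fieldType) (n : nat) (u v : 'rV[K]_n) (p q : mpoly n K) k :
  mline u v (iter_num p 0 (nseq k v) q) = deriv_num (mline u v p) (mline u v q) k.
Proof.
elim: k => //= k <-; rewrite !deriv_mline size_nseq add0n.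
by rewrite rmorphB rmorphMn !rmorphM.
Qed.

Definition iter_quo (K : fieldType) (n : nat) (p g : mpoly n K) (u : 'rV[K]_n)
    (l : seq 'rV[K]_n) : K :=
  evalp (iter_num p 0 l g) u / evalp p u ^+ (size l).+1.

Lemma quotient_coef_mline (K : fieldType) (n : nat) (p g : mpoly n K)
    (u v : 'rV[K]_n) k :
  quotient_coef (mline u v p) (mline u v g) k =
  iter_quo p g u (nseq k v) / k`!%:R.
Proof.
rewrite /quotient_coef -mline_iter_num !horner_mline scale0r addr0 /iter_quo.
by rewrite size_nseq invfM mulrA.
Qed.

Lemma iter_quo_dir (K : fieldType) (n : nat) (p g : mpoly n K) (u v w : 'rV[K]_n)
    a b l1 l2 :
  iter_quo p g u (l1 ++ (a *: v + b *: w) :: l2) =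
  a * iter_quo p g u (l1 ++ v :: l2) + b * iter_quo p g u (l1 ++ w :: l2).
Proof.
by rewrite /iter_quo iter_num_dir evalpD !evalpZ !size_cat /= mulrDl -!mulrA.
Qed.

(** Multilinear expansion: both sides become sums over words in [v] and [w], whose values are
    nonnegative and whose coefficients on the left have norm at most [r ^ k]. The induction moves
    chosen letters into the tail [l], which preserves the order of differentiation. *)
Lemma iter_quo_bound (K : numFieldType) (n : nat) (p g : mpoly n K)
    (u v w : 'rV[K]_n) (a b r : K) k :
  `|a| <= r -> `|b| <= r ->
  (forall l, {subset l <= [:: v; w]} -> 0 <= iter_quo p g u l) ->
  `|iter_quo p g u (nseq k (a *: v + b *: w))| <=
    r ^+ k * iter_quo p g u (nseq k (v + w)).
Proof.
move=> ar br gP; rewrite -[nseq k (a *: _ + _)]cats0 -[nseq k (v + _)]cats0.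
have r0 : 0 <= r by apply: le_trans ar.
suff: forall l, {subset l <= [:: v; w]} ->
    `|iter_quo p g u (nseq k (a *: v + b *: w) ++ l)| <=
    r ^+ k * iter_quo p g u (nseq k (v + w) ++ l) by apply.
elim: k => [|k IHk] l lP.
  by rewrite /= expr0 mul1r ger0_norm //; exact: gP.
have nE x : nseq k.+1 x ++ l = nseq k x ++ x :: l.
  by rewrite -[k.+1]addn1 nseqD -catA.
have vP : {subset v :: l <= [:: v; w]}.
  by move=> x; rewrite inE => /orP[/eqP ->|/lP//]; rewrite inE eqxx.
have wP : {subset w :: l <= [:: v; w]}.
  by move=> x; rewrite inE => /orP[/eqP ->|/lP//]; rewrite !inE eqxx orbT.
have addE l1 : iter_quo p g u (l1 ++ (v + w) :: l) =
    iter_quo p g u (l1 ++ v :: l) + iter_quo p g u (l1 ++ w :: l).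
  by have := iter_quo_dir p g u v w 1 1 l1 l; rewrite !scale1r !mul1r.
rewrite !nE addE iter_quo_dir.
rewrite (le_trans (ler_normD _ _)) // (normrM a) (normrM b) exprS mulrDr -!mulrA.
by apply: lerD; apply: ler_pM => //; apply: IHk.
Qed.

(** * Completely monotone quotients *)

Section DeriveEvalp.
Variables (R : realType) (m : nat).
Implicit Types (x v : 'rV[R]_m.+1) (p q : mpoly m.+1 R).

Lemma is_derive_evalp p x v :
  is_derive x v (fun y => evalp p y) (evalp (mdird v p) x).
Proof.
elim/mpoly_ring_ind: p => [c|j|p q IHp IHq|p q IHp IHq].
- rewrite mdirdC -mpolyC0 evalpC (_ : (fun y => _) = cst c).
    exact: is_derive_cst.
  by apply/funext => y; rewrite evalpC.
- rewrite mdirdXU evalpC (_ : (fun y => _) = (fun y : 'rV[R]_m.+1 => y 0 j)); last first.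
    by apply/funext => y; rewrite evalpXU.
  have @f : {linear 'rV[R]_m.+1 -> R}.
    by exists (fun y : 'rV[R]_m.+1 => y 0 j); do 2![eexists]; do ?[constructor];
       rewrite ?mxE // => ? *; rewrite ?mxE //; move=> ?; rewrite !mxE.
  rewrite (_ : (fun y => _) = f) // -[v 0 j]/(f v).
  have cf : continuous f by exact: coord_continuous.
  have df : differentiable f x by exact: linear_differentiable.
  by apply: DeriveDef; [exact: diff_derivable | rewrite deriveE // diff_lin].
- rewrite mdirdD evalpD (_ : (fun y => _) = (fun y => evalp p y) + (fun y => evalp q y)).
    exact: is_deriveD.
  by apply/funext => y; rewrite evalpD.
- rewrite mdirdM evalpD !evalpM (_ : (fun y => _) = (fun y => evalp p y) * (fun y => evalp q y)).
    apply: is_derive_eq; rewrite addrC /GRing.scale /=; congr (_ + _).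
    by rewrite mulrC.
  by apply/funext => y; rewrite evalpM.
Qed.

Lemma iter_quo_cons p g x v l :
  evalp p x != 0 -> is_derive x v (fun y => iter_quo p g y l) (iter_quo p g x (v :: l)).
Proof.
move=> p0; rewrite /iter_quo /=.
have dp := is_derive_evalp p x v.
have dn := is_derive_evalp (iter_num p 0 l g) x v.
have pk0 : evalp p x ^+ (size l).+1 != 0 by rewrite expf_neq0.
have dpk : is_derive x v (fun y => evalp p y ^+ (size l).+1)
    ((size l).+1%:R * evalp p x ^+ (size l) * evalp (mdird v p) x).
  rewrite (_ : (fun y => _) = (fun y => evalp p y) ^+ (size l).+1); last first.
    by apply/funext => y; rewrite exprfctE.
  exact: is_deriveX.
have dv : is_derive x v (fun y => (evalp p y ^+ (size l).+1)^-1)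
    (- (evalp p x ^+ (size l).+1) ^- 2 * ((size l).+1%:R * evalp p x ^+ (size l) * evalp (mdird v p) x)).
  apply: DeriveDef; first by apply: derivableV => //; exact: ex_derive.
  by rewrite deriveV // derive_val.
rewrite (_ : (fun y => _) = (fun y => evalp (iter_num p 0 l g) y) *
    (fun y => (evalp p y ^+ (size l).+1)^-1)) //.
apply: is_derive_eq.
rewrite /GRing.scale /= evalpD evalpN.
have evalpMn h k : evalp (h *+ k) x = evalp h x *+ k by exact: mevalMn.
rewrite evalpMn !evalpM -mulr_natr.
rewrite !exprS -/(evalp p x).
set N := evalp (iter_num p 0 l g) x; set P := evalp p x in p0 pk0 *.
by field; rewrite expf_neq0 // p0.
Qed.

End DeriveEvalp.

Section OpenCone.
Variables (R : realType) (m : nat) (C : set 'rV[R]_m.+1) (p g : mpoly m.+1 R).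
Hypothesis oC : open C.
Hypothesis pC : forall x, C x -> evalp p x != 0.

Lemma iter_derive_quo l x : C x ->
  iter_derive l (fun y => evalp g y / evalp p y) x = iter_quo p g x l.
Proof.
elim: l x => [|v l IHl] x Cx; first by rewrite /iter_quo expr1.
rewrite /= -(derive_val (is_derive := iter_quo_cons g v l (pC Cx))).
by apply: near_eq_derive; apply: filterS (IHl) _; exact: open_nbhs_nbhs.
Qed.

Lemma iter_num_opp k l h :
  iter_num p k (map -%R l) h = (-1) ^+ size l *: iter_num p k l h.
Proof.
elim: l => [|v l IHl] /=; first by rewrite expr0 scale1r.
have mN w f : mdird (- w) f = - mdird w f.
  by have := mdird_lin (-1) 0 w 0 f; rewrite scaler0 addr0 !scaleN1r scale0r addr0.
rewrite IHl !mN mdirdZ size_map exprS -!mul_mpolyC mpolyCM.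
by rewrite mpolyCN mpolyC1; ring.
Qed.

Lemma iter_quo_opp l x :
  iter_quo p g x (map -%R l) = (-1) ^+ size l * iter_quo p g x l.
Proof. by rewrite /iter_quo iter_num_opp evalpZ size_map mulrA. Qed.

(** Negating the directions absorbs the sign [(-1)^r] of complete monotonicity. *)
Lemma completely_monotone_iter_quo l x :
  completely_monotone C (fun y => evalp g y / evalp p y) ->
  (forall v, v \in l -> C (- v)) -> C x -> 0 <= iter_quo p g x l.
Proof.
move=> [_ _ cm] lC Cx; have -> : l = map -%R (map -%R l).
  by rewrite -map_comp map_id_in // => v _ /=; rewrite opprK.
rewrite iter_quo_opp -iter_derive_quo //; apply: cm => // v /mapP[w wl ->].
exact: lC.
Qed.

End OpenCone.

(** A Cauchy estimate by monotonicity: the difference between [f j] and its Taylor term of order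
    [k + 1] is nonnegative at 0, and its derivative is nonnegative by the case [k] for [f j.+1]. *)
Lemma taylor_term_le (R : realType) (f : nat -> R -> R) (rho : R) :
  (forall j t, 0 <= t <= rho -> is_derive t 1 (f j) (f j.+1 t)) ->
  (forall j t, 0 <= t <= rho -> 0 <= f j t) ->
  forall k j t, 0 <= t <= rho -> f (j + k)%N 0 * t ^+ k / k`!%:R <= f j t.
Proof.
move=> df f0.
have ndecr (h dh : R -> R) : (forall t, 0 <= t <= rho -> is_derive t 1 h (dh t)) ->
    (forall t, 0 <= t <= rho -> 0 <= dh t) ->
    forall t, 0 <= t <= rho -> h 0 <= h t.
  move=> hdh dh0 t /andP[t0 trho].
  have itvP s : s \in `]0, rho[ -> 0 <= s <= rho.
    by rewrite in_itv /= => /andP[? ?]; rewrite !ltW.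
  apply: (@ger0_derive1_ndecr _ h 0 rho) => // [s /itvP|s /itvP|].
  - by move=> sP; case: (hdh s sP).
  - by move=> sP; rewrite derive1E (derive_val (is_derive := hdh s sP)) dh0.
  - apply: derivable_within_continuous => s; rewrite in_itv /= => sP.
    by case: (hdh s sP).
elim=> [|k IHk] j t trho.
  rewrite addn0 expr0 mulr1 fact0 divr1.
  by apply: (ndecr (f j) (f j.+1)) => // s; exact: f0.
pose c := f (j + k.+1)%N 0 / k.+1`!%:R.
rewrite -mulrA [_ ^+ _ / _]mulrC mulrA -/c -subr_ge0.
have h0 : 0 <= f j 0 - c * 0 ^+ k.+1.
  rewrite expr0n mulr0 subr0; apply: f0; rewrite lexx.
  by case/andP: trho; exact: le_trans.
apply: le_trans h0 _.
apply: (ndecr (fun s => f j s - c * s ^+ k.+1)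
  (fun s => f j.+1 s - f (j.+1 + k)%N 0 * s ^+ k / k`!%:R)) => // s sP; last first.
  by rewrite subr_ge0; exact: IHk.
have dfj := df j s sP.
rewrite (_ : (fun s => _) = f j - c \*: (@id R ^+ k.+1)); last first.
  apply/funext => y; rewrite -[RHS]/(f j y - c * (@id R ^+ k.+1) y).
  by rewrite exprfctE.
apply: is_derive_eq.
rewrite /GRing.scale /= mulr1 addSnnS; congr (_ - _).
rewrite /c factS natrM.
have k0 : k.+1%:R != 0 :> R by rewrite pnatr_eq0.
have kf0 : k`!%:R != 0 :> R by rewrite pnatr_eq0 -lt0n fact_gt0.
move: (k.+1%:R) (k`!%:R) k0 kf0 => K F K0 F0.
by field; rewrite K0 F0.
Qed.
(** * Zeros in the tube over a cone *)

Section ConvexCone.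
Variables (R : realType) (m : nat) (C : set 'rV[R]_m.+1).
Hypothesis coneC : open_convex_cone C.

Lemma cone_conv x y (t : R) : C x -> C y -> 0 <= t <= 1 -> C (t *: x + (1 - t) *: y).
Proof.
move=> Cx Cy /andP[t0 t1]; have [_ cC _] := coneC.
by have := cC x y (Itv01 t0 t1); rewrite !inE; apply.
Qed.

Lemma coneZ x (t : R) : 0 < t -> C x -> C (t *: x).
Proof. by case: coneC => _ _; apply. Qed.

Lemma coneD x y : C x -> C y -> C (x + y).
Proof.
move=> Cx Cy; have h2 : 0 <= (2^-1 : R) <= 1 by lra.
have := coneZ (ltr0Sn R 1) (cone_conv Cx Cy h2).
rewrite scalerDr !scalerA (_ : 2 * 2^-1 = 1 :> R); last by lra.
by rewrite (_ : 2 * (1 - 2^-1) = 1 :> R) ?scale1r //; lra.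
Qed.

Lemma open_segment (U : set 'rV[R]_m.+1) x v : open U -> U x ->
  exists2 e : R, 0 < e & forall t, `|t| < e -> U (x + t *: v).
Proof.
move=> oU Ux; have : nbhs x U by exact: open_nbhs_nbhs.
have ct : (fun t : R => x + t *: v) @ (0 : R) --> x + (0 : R) *: v.
  by apply: cvgD; [exact: cvg_cst | exact: scalel_continuous].
rewrite scale0r addr0 in ct.
move=> /ct /nbhs_ballP[e /= e0 eU]; exists e => // t te.
by apply: eU; rewrite /ball /= sub0r normrN.
Qed.

(** For large [t], [t x + v = t (x + v / t)] is a positive multiple of a point near [x]. Hence every
    vector is a difference of two elements of [C]. *)
Lemma cone_absorb x v : C x -> exists2 t, 0 < t & C (t *: x + v).
Proof.
move=> Cx; have [oC _ _] := coneC; have [e e0 eC] := open_segment v oC Cx.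
have e2 : 0 < e / 2 by lra.
exists (e / 2)^-1; rewrite ?invr_gt0 //.
have -> : (e / 2)^-1 *: x + v = (e / 2)^-1 *: (x + (e / 2) *: v).
  by rewrite scalerDr scalerA mulVf ?scale1r // gt_eqF.
by apply: coneZ; rewrite ?invr_gt0 //; apply: eC; rewrite gtr0_norm //; lra.
Qed.

End ConvexCone.

Lemma toC_D (R : realType) (k n : nat) (x y : 'M[R]_(k, n)) : toC (x + y) = toC x + toC y.
Proof. by rewrite /toC map_mxD. Qed.

Lemma toC_Z (R : realType) (k n : nat) a (x : 'M[R]_(k, n)) :
  toC (a *: x) = real_complex R a *: toC x.
Proof. by rewrite /toC map_mxZ. Qed.

Lemma toC_N (R : realType) (k n : nat) (x : 'M[R]_(k, n)) : toC (- x) = - toC x.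
Proof. by rewrite /toC map_mxN. Qed.

Lemma evalp_complexp (R : realType) (n : nat) (p : mpoly n R) x :
  evalp (complexp p) (toC x) = real_complex R (evalp p x).
Proof. by rewrite /complexp evalp_map evalm_map. Qed.

Lemma iter_quo_complex (R : realType) (n : nat) (p g : mpoly n R) x l :
  iter_quo (complexp p) (complexp g) (toC x) (map (@toC R 1 n) l) =
  real_complex R (iter_quo p g x l).
Proof.
have E : iter_num (complexp p) 0 (map (@toC R 1 n) l) (complexp g) =
    complexp (iter_num p 0 l g).
  exact: esym (map_iter_num (real_complex R) p g 0 l).
have E1 := congr1 (fun f => evalp f (toC x)) E; have E2 := evalp_complexp p x.
rewrite /= (evalp_complexp (iter_num p 0 l g)) in E1.
rewrite [LHS]/iter_quo E1 E2 size_map /iter_quo.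
by rewrite [RHS](fmorph_div (real_complex R)) [X in _ = _ / X](rmorphXn (real_complex R)).
Qed.

Lemma subset_map (T1 T2 : eqType) (f : T1 -> T2) (s : seq T1) (l : seq T2) :
  {subset l <= map f s} -> exists2 l', l = map f l' & {subset l' <= s}.
Proof.
elim: l => [|y l IHl] ls; first by exists [::].
have /mapP[x xs ->] : y \in map f s by apply: ls; rewrite mem_head.
have [|l' -> l's] := IHl; first by move=> z zl; apply: ls; rewrite inE zl orbT.
exists (x :: l') => // z; rewrite inE => /orP[/eqP ->//|]; exact: l's.
Qed.

Lemma geometric_small (R : realType) (th : R) : 0 <= th < 1 ->
  forall eps, 0 < eps -> exists n, th ^+ n < eps.
Proof.
move=> /andP[th0 th1] eps e0.
have /cvgrPdist_lt /(_ _ e0) [n _ /(_ n (leqnn n))] : (GRing.exp th : R^nat) @ \oo --> 0.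
  by apply: cvg_expr; rewrite ger0_norm.
by rewrite /= sub0r normrN ger0_norm ?exprn_ge0 // => ?; exists n.
Qed.

(** [(N + 1 / (2 N))^2 = N^2 + 1 + 1 / (4 N^2)] exceeds [N^2 + 1], the squared norm of [N + i] and
    [N - i]. *)
Lemma complex_shift_norm (R : realType) (N : R) (sgn : bool) : 0 < N ->
  `|real_complex R N + (if sgn then 'i%C else - 'i%C)| <= real_complex R (N + N^-1 / 2).
Proof.
move=> N0; rewrite normc_def lecR.
have NV : 0 < N^-1 by rewrite invr_gt0.
have M0 : 0 <= N + N^-1 / 2 by lra.
rewrite -(ger0_norm M0) -sqrtr_sqr ler_wsqrtr //.
have NN : N * N^-1 = 1 by rewrite mulfV ?gt_eqF.
by case: sgn => /=; nra.
Qed.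

Lemma tube_pointE (K : comNzRingType) (n : nat) (u v w : 'rV[K]_n) (N i0 : K) :
  u + i0 *: (v - w) =
  u + N *: (v + w) + ((N - i0) *: - v + (N + i0) *: - w).
Proof. by apply/rowP => k; rewrite !mxE; ring. Qed.

Lemma is_derive_line (R : realType) (m : nat) (F : 'rV[R]_m.+1 -> R) u v (t dF : R) :
  is_derive (u + t *: v) v F dF -> is_derive t 1 (fun s : R => F (u + s *: v)) dF.
Proof.
move=> [dv <-].
have E : (fun h : R => h^-1 *: ((F \o shift (u + t *: v)) (h *: v) - F (u + t *: v))) =
  (fun h : R => h^-1 *: (((fun s : R => F (u + s *: v)) \o shift t) (h *: 1) - F (u + t *: v))).
  apply/funext => h /=; congr (_ *: (F _ - _)).
  by rewrite addrCA -scalerDl /GRing.scale /= mulr1.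
by apply: DeriveDef; rewrite /derivable /derive -E.
Qed.

Lemma geometric_rescale (R : realFieldType) (A M F r rho : R) n :
  0 < r -> 0 < rho -> 0 < F -> A * rho ^+ n / F <= M ->
  r ^+ n * A <= M * (r / rho) ^+ n * F.
Proof.
move=> r0 rho0 F0; rewrite ler_pdivrMr // => AM.
have -> : M * (r / rho) ^+ n * F = r ^+ n * (M * F) / rho ^+ n.
  by rewrite expr_div_n; ring.
by rewrite ler_pdivlMr ?exprn_gt0 // -mulrA ler_pM2l ?exprn_gt0.
Qed.

Section Tube.
Variables (R : realType) (m : nat) (C : set 'rV[R]_m.+1) (p g : mpoly m.+1 R).
Hypothesis coneC : open_convex_cone C.
Hypothesis pC : forall x, C x -> evalp p x != 0.
Hypothesis cmC : forall l x, (forall v, v \in l -> C (- v)) -> C x ->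
  0 <= iter_quo p g x l.

(* With [y = v - w], [U = u + N (v + w)] and [v, w] in [C], the point [u + i y]
   is [U - (N - i) v - (N + i) w].  The Taylor coefficients of [g / p] at [U] in
   the directions [- v] and [- w] are nonnegative, so those in the complex
   direction are at most [|N + i| ^ k] times those in the direction [- (v + w)];
   the latter are bounded by the value of [g / p] at
   [U - rho (v + w) = u - (v + w) / N], where [rho = N + 1 / N > |N + i|]. *)
Lemma tube_common_zero u y : C u ->
  evalp (complexp p) (toC u + 'i%C *: toC y) = 0 ->
  evalp (complexp g) (toC u + 'i%C *: toC y) = 0.
Proof.
move=> Cu pz.
have [v [w [Cv Cw yE]]] : exists v w, [/\ C v, C w & y = v - w].
  have [s s0 Cv] := cone_absorb coneC y Cu.
  by exists (s *: u + y), (s *: u); split=> //; [exact: coneZ | rewrite addrAC subrr add0r].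
pose c := v + w.
have [oC _ _] := coneC.
have [e e0 eC] := open_segment c oC Cu.
(* [1 / N = e / 2 < e] keeps [u - c / N] in [C]. The number [r] lies between the norm of [N + i] and
   [rho], so [r / rho < 1] is a ratio of geometric decay. *)
pose N := 2 / e; pose rho := N + N^-1; pose r := N + N^-1 / 2.
have N0 : 0 < N by rewrite divr_gt0.
pose U := u + N *: c; pose x := - v; pose z := - w.
have Cc : C c by apply: coneD.
have CU : C U by apply: coneD => //; exact: coneZ.
have CUrho : C (U + rho *: (x + z)).
  have -> : U + rho *: (x + z) = u + (- N^-1) *: c.
    rewrite /U /x /z /rho -opprD -/c scalerN scaleNr scalerDl.
    by rewrite -addrA opprD addrA addrA addrK.
  by apply: eC; rewrite normrN gtr0_norm ?invr_gt0 // /N invf_div; lra.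
have rho0 : 0 < rho by rewrite addr_gt0 ?invr_gt0.
have NV : 0 < N^-1 by rewrite invr_gt0.
have r0 : 0 < r by rewrite /r; lra.
have rr : r < rho by rewrite /r /rho; lra.
have th01 : 0 <= r / rho < 1.
  by rewrite divr_ge0 ?(ltW r0) ?(ltW rho0) //= ltr_pdivrMr // mul1r.
have Ct t : 0 <= t <= rho -> C (U + t *: (x + z)).
  move=> /andP[t0 tr].
  have -> : U + t *: (x + z) = (t / rho) *: (U + rho *: (x + z)) + (1 - t / rho) *: U.
    move: (x + z) => d; rewrite [in RHS]scalerDr scalerA divfK ?gt_eqF //.
    rewrite scalerBl scale1r [RHS]addrAC; congr (_ + _).
    by rewrite addrC subrK.
  apply: cone_conv => //; rewrite divr_ge0 ?(ltW rho0) //=.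
  by rewrite ler_pdivrMr // mul1r.
pose a : R[i] := real_complex R N - 'i%C; pose b : R[i] := real_complex R N + 'i%C.
pose xi := a *: toC x + b *: toC z.
have zE : toC u + 'i%C *: toC y = toC U + 1 *: xi.
  have -> : toC y = toC v - toC w by rewrite yE toC_D toC_N.
  rewrite scale1r /xi /a /b /U /c /x /z !toC_D !toC_N !toC_Z !toC_D.
  exact: tube_pointE.
pose f j (t : R) : R := iter_quo p g (U + t *: (x + z)) (nseq j (x + z)).
have wordC j t : 0 <= t <= rho -> 0 <= f j t.
  move=> tr; apply: cmC; last exact: Ct.
  by move=> d /nseqP[-> _]; rewrite /x /z -opprD opprK.
have df j (t : R) : 0 <= t <= rho -> is_derive t 1 (f j) (f j.+1 t).
  move=> tr.
  exact: (is_derive_line (iter_quo_cons g (x + z) (nseq j (x + z)) (pC (Ct t tr)))).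
have fU k : f k 0 * rho ^+ k / k`!%:R <= f 0 rho.
  by have := taylor_term_le df wordC k 0 _; apply; rewrite lexx ltW.
have xiP k : `|iter_quo (complexp p) (complexp g) (toC U) (nseq k xi)| <=
    real_complex R (r ^+ k * f k 0).
  have H := iter_quo_bound (p := complexp p) (g := complexp g) (u := toC U)
    (v := toC x) (w := toC z) (a := a) (b := b) (r := real_complex R r) k.
  apply: le_trans (H _ _ _) _.
  - exact: (complex_shift_norm false N0).
  - exact: (complex_shift_norm true N0).
  - move=> l /(@subset_map _ _ (@toC R 1 m.+1) [:: x; z])[l' -> l'P].
    rewrite (iter_quo_complex p g U l').
    rewrite -[0]/(real_complex R 0).
    rewrite lecR.
    apply: cmC CU => d /l'P.
    by rewrite !inE => /orP[] /eqP ->; rewrite opprK.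
  - rewrite -toC_D -map_nseq iter_quo_complex.
    by rewrite /f scale0r addr0 [X in _ <= X](rmorphM (real_complex R)) [X in _ <= X * _](rmorphXn (real_complex R)).
(* On the line from [U] with direction [xi], the parameter 1 gives the point [u + i y], where
   [quotient_root1] applies. *)
pose P := mline (toC U) xi (complexp p); pose Q := mline (toC U) xi (complexp g).
have P0 : P.[0] != 0.
  have -> : P.[0] = real_complex R (evalp p U).
    apply: etrans (horner_mline _ _ _ _) _; rewrite scale0r addr0.
    exact: evalp_complexp.
  by rewrite fmorph_eq0 pC.
have f0 : 0 <= f 0 rho by apply: wordC; rewrite lexx ltW.
have PE : P.[1] = evalp (complexp p) (toC u + 'i%C *: toC y).
  exact: etrans (horner_mline _ _ _ _) (congr1 (evalp (complexp p)) (esym zE)).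
have QE : Q.[1] = evalp (complexp g) (toC u + 'i%C *: toC y).
  exact: etrans (horner_mline _ _ _ _) (congr1 (evalp (complexp g)) (esym zE)).
have P1 : P.[1] = 0 by exact: etrans PE pz.
rewrite -QE.
have PQa n := quotient_coefP Q n P0.
have f0C : 0 <= real_complex R (f 0 rho) by rewrite -[0]/(real_complex R 0) lecR.
have thC : 0 <= real_complex R (r / rho) <= 1.
  rewrite -[0]/(real_complex R 0) -[1]/(real_complex R 1) !lecR.
  by case/andP: th01 => -> /ltW ->.
have small eps : 0 < eps -> exists n, real_complex R (r / rho) ^+ n < eps.
  rewrite -[0]/(real_complex R 0) ltcE /= => /andP[/eqP im0 re0].
  have [k thk] := geometric_small th01 re0; exists k.
  rewrite -(rmorphXn (real_complex R)) ltcE /= im0 eqxx.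
  exact: thk.
apply: (quotient_root1 PQa f0C thC small _ P1) => n.
rewrite /P /Q quotient_coef_mline normrM normfV normr_nat.
have n0 : 0 < n`!%:R :> R by rewrite ltr0n fact_gt0.
rewrite -(rmorphXn (real_complex R)) -(rmorphM (real_complex R)).
rewrite -(rmorph_nat (real_complex R)).
rewrite ler_pdivrMr.
  apply: le_trans (xiP n) _; rewrite -(rmorphM (real_complex R)) lecR.
  exact: geometric_rescale (fU n).
by rewrite -[0]/(real_complex R 0) ltcR.
Qed.
End Tube.

(** * Generic points and continuity of roots *)

Lemma poly_recip_nonroot (K : numFieldType) (S : {poly K}) : S != 0 ->
  exists N, forall k, (N <= k)%N -> S.[k%:R^-1] != 0.
Proof.
have [d] := ubnP (size S); elim: d S => // d IHd S Sd S0.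
have [noroot|] := pselect (forall k : nat, S.[k%:R^-1] != 0); first by exists 0.
move=> /existsNP[k0 /negP/negPn/factor_theorem[S' SE]].
have S'0 : S' != 0 by apply: contraNneq S0 => S'0; rewrite SE S'0 mul0r.
have [|N NP] := IHd S' _ S'0.
  by move: Sd; rewrite SE size_Mmonic ?monicXsubC // size_XsubC addn2.
(* The inverses [1 / k] are distinct, so the root [1 / k0] is avoided beyond [k0]. *)
exists (maxn N k0.+1) => k; rewrite geq_max => /andP[Nk k0k].
rewrite SE hornerM mulf_neq0 ?NP // hornerXsubC subr_eq0 (inj_eq (@invr_inj _)).
by rewrite eqr_nat gtn_eqF.
Qed.

(** Induction on a degree bound: restrictions to lines vanish, so the partial derivatives vanish
    everywhere and are 0 by induction; in characteristic 0 only a constant remains. *)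
Lemma mpoly_vanish (K : numFieldType) (n : nat) (p : mpoly n K) :
  (forall z, evalp p z = 0) -> p = 0.
Proof.
suff: forall k (p : mpoly n K), (forall m, m \in msupp p -> (mdeg m < k)%N) ->
    (forall z, evalp p z = 0) -> p = 0.
  by move=> /(_ (msize p) p); apply=> m; exact: msize_mdeg_lt.
move=> {p}; elim=> [|k IHk] p pk pz.
  apply/mpolyP => m; rewrite mcoeff0; apply: memN_msupp_eq0.
  by apply/negP => /pk.
have dp i : mderiv i p = 0.
  apply: IHk => [m|z].
    rewrite mcoeff_msupp mcoeff_mderiv => pm.
    have : mnm_add m (mnm1 i) \in msupp p.
      by rewrite mcoeff_msupp; apply: contraNneq pm => ->; rewrite mul0rn.
    by move=> /pk; rewrite mdegD mdeg1 addn1 ltnS.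
  pose v : 'rV[K]_n := delta_mx 0 i.
  have S0 : mline z v p = 0.
    apply: contrapT => /eqP /poly_recip_nonroot[N /(_ N (leqnn N))].
    by rewrite horner_mline pz eqxx.
  have <- : mdird v p = mderiv i p.
    rewrite /mdird (bigD1 i) //= big1 => [|j ji]; rewrite mxE !eqxx /=.
      by rewrite scale1r addr0.
    by rewrite (negPf ji) scale0r.
  have := deriv_mline z v p; rewrite S0 deriv0 => /(congr1 (horner^~ 0)).
  by rewrite horner_mline horner0 scale0r addr0.
have pC : p = (mcoeff mnm0 p)%:MP.
  apply/mpolyP => m; rewrite mcoeffC; case: eqP => [->|/eqP m0]; first by rewrite mulr1.
  rewrite mulr0.
  have [i mi] : exists i, m i != 0%N.
    apply/existsP; apply: contraNT m0; rewrite negb_exists => /forallP m0.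
    by apply/eqP/mnmP => i; rewrite mnm0E; apply/eqP; rewrite -[_ == _]negbK m0.
  have := congr1 (mcoeff (mnm_sub m (mnm1 i))) (dp i).
  rewrite mcoeff_mderiv mcoeff0 => /eqP; rewrite mulrn_eq0 /= => /eqP.
  rewrite submK //; apply/mnm_lepP => j; rewrite mnm1E.
  by case: eqP => [<-|//]; rewrite lt0n.
by have := pz 0; rewrite pC evalpC => ->; rewrite mpolyC0.
Qed.

Lemma mpoly_nonvanishing (K : numFieldType) (n : nat) (s : mpoly n K) z : s != 0 ->
  exists w N, forall k, (N <= k)%N -> evalp s (z + k%:R^-1 *: w) != 0.
Proof.
move=> s0; have [w sw] : exists w, evalp s w != 0.
  apply: contrapT => /forallNP sw; move/eqP: s0; apply; apply: mpoly_vanish => w.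
  by apply/eqP; rewrite -[_ == _]negbK; apply/negP; exact: sw.
exists (w - z).
have [|N NP] := @poly_recip_nonroot _ (mline z (w - z) s).
  apply: contraNneq sw => S0.
  by rewrite -[w](subrKC z) -[w - z]scale1r -horner_mline S0 horner0.
by exists N => k /NP; rewrite horner_mline.
Qed.

(** The product of the roots has norm [|T(0)| / |lead_coef T|], too small for all of them to have
    norm at least [eps]. *)
Lemma small_root (K : numClosedFieldType) (T : {poly K}) (d : nat) (eps : K) :
  size T = d.+1 -> 0 <= eps -> `|T.[0]| < `|lead_coef T| * eps ^+ d ->
  exists2 t, T.[t] = 0 & `|t| < eps.
Proof.
move=> Td eps0 T0; have [r TE] := closed_field_poly_normal T.
have lT0 : lead_coef T != 0 by rewrite lead_coef_eq0 -size_poly_eq0 Td.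
have rd : size r = d.
  move: Td; rewrite TE size_scale // size_prod_XsubC => -[->//].
apply: contrapT => /forall2NP noroot.
have re t : t \in r -> eps <= `|t|.
  move=> tr; have [Tt|] := noroot t.
    by case: Tt; rewrite TE hornerZ horner_prod (big_rem t) //= hornerXsubC subrr mul0r mulr0.
  by move=> /negP; rewrite -real_leNgt ?ger0_real.
suff : `|lead_coef T| * eps ^+ d <= `|T.[0]|.
  by move=> /(lt_le_trans T0); rewrite ltxx.
rewrite [in leRHS]TE hornerZ normrM ler_wpM2l // horner_prod normr_prod -rd.
elim: r re {TE rd noroot} => [|t r IHr] re; first by rewrite big_nil expr0.
rewrite big_cons /= exprS hornerXsubC sub0r normrN ler_pM ?exprn_ge0 //.
  by apply: re; rewrite mem_head.
by apply: IHr => x xr; apply: re; rewrite inE xr orbT.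
Qed.

Lemma mline_top (K : comNzRingType) (n d : nat) (u v : 'rV[K]_n) (p : mpoly n K) :
  homog d p -> (size (mline u v p) <= d.+1)%N /\ (mline u v p)`_d = evalp p v.
Proof.
pose top k c (P : {poly K}) := (size P <= k.+1)%N /\ P`_k = c.
have topM k l b c P Q : top k b P -> top l c Q -> top (k + l)%N (b * c) (P * Q).
  move=> [sP <-] [sQ <-]; split.
    apply: leq_trans (size_polyMleq _ _) _.
    by move: (size P) (size Q) sP sQ => sP sQ; lia.
  rewrite coefM (bigD1 (inord k)) //= inordK ?ltnS ?leq_addr // addKn big1 ?addr0 // => j.
  rewrite -val_eqE /= inordK ?ltnS ?leq_addr // neq_ltn => /orP[jk|kj].
    by rewrite [Q`__]nth_default ?mulr0 // (leq_trans sQ) //; lia.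
  by rewrite [P`__]nth_default ?mul0r // (leq_trans sP).
have topX k b P j : top k b P -> top (k * j)%N (b ^+ j) (P ^+ j).
  move=> tP; elim: j => [|j IHj]; last by rewrite mulnS !exprS; apply: topM.
  by rewrite muln0 !expr0; split; rewrite ?size_poly1 // coef1.
move=> /dhomogP pd.
pose h i : {poly K} := (u 0 i)%:P + v 0 i *: 'X.
have hT i : top 1%N (v 0 i) (h i).
  split; last by rewrite coefD coefC coefZ coefX add0r mulr1.
  rewrite (leq_trans (size_polyD _ _)) // geq_max.
  by rewrite (leq_trans (size_polyC_leq1 _)) ?(leq_trans (size_scale_leq _ _)) ?size_polyX.
have mT m : top (mdeg m) (\prod_i v 0 i ^+ m i) (mmap1 h m).
  rewrite mdegE /mmap1; elim/big_rec3 : _ => [|i a b c _ T]; first by split; rewrite ?size_poly1 // coef1.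
  by apply: topM => //; have := topX _ _ _ (m i) (hT i); rewrite mul1n.
have topD b c P Q : top d b P -> top d c Q -> top d (b + c) (P + Q).
  move=> [sP <-] [sQ <-]; split; last by rewrite coefD.
  by rewrite (leq_trans (size_polyD _ _)) // geq_max sP.
suff: top d (evalp p v) (mline u v p) by [].
rewrite /mline /evalp mevalE /mmap big_seq [X in top d _ X]big_seq.
elim/big_rec2: _ => [|m b c mp]; first by split; rewrite ?size_poly0 ?coef0.
apply: topD; have <- : mdeg m = d by exact: pd.
have [sm <-] := mT m; rewrite mul_polyC; split; last by rewrite coefZ.
by rewrite (leq_trans (size_scale_leq _ _)).
Qed.

(** The leading coefficient [p(v)] does not depend on [u]: translating the line never lowers the
    degree of the restriction. *)
Lemma size_mline (K : comNzRingType) (n d : nat) (u v : 'rV[K]_n) (p : mpoly n K) :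
  homog d p -> evalp p v != 0 ->
  size (mline u v p) = d.+1 /\ lead_coef (mline u v p) = evalp p v.
Proof.
move=> pd pv; have [sp pE] := mline_top u v pd.
have sE : size (mline u v p) = d.+1.
  apply/eqP; rewrite eqn_leq sp ltnNge; apply/negP => sd.
  by move/eqP: pv; apply; rewrite -pE nth_default.
by rewrite lead_coefE sE.
Qed.
Lemma complexp_eq0 (R : realType) (n : nat) (p : mpoly n R) :
  complexp p = 0 -> p = 0.
Proof.
move=> p0; apply/mpolyP => m; have := congr1 (mcoeff m) p0.
by rewrite mcoeff_map_mpoly !mcoeff0 => /complexI.
Qed.

Lemma homog_complexp (R : realType) (n d : nat) (p : mpoly n R) :
  homog d p -> homog d (complexp p).
Proof.
move=> /dhomogP pd; apply/dhomogP => m; rewrite mcoeff_msupp mcoeff_map_mpoly => pm.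
by apply: pd; rewrite mcoeff_msupp; apply: contraNneq pm => ->.
Qed.

Lemma complex_rowE (R : realType) (n : nat) (w : 'rV[R[i]]_n) :
  exists w1 w2, w = toC w1 + 'i%C *: toC w2.
Proof.
exists (map_mx (@complex.Re R) w), (map_mx (@complex.Im R) w).
by apply/rowP => j; rewrite !mxE; exact: complexE.
Qed.

Lemma norm_complexE (R : realType) (z : R[i]) :
  `|z| = real_complex R (complex.Re `|z|).
Proof. by rewrite normc_def. Qed.

Lemma Re_le_norm (R : realType) (z : R[i]) : `|complex.Re z| <= complex.Re `|z|.
Proof.
rewrite normc_def /= -sqrtr_sqr ler_wsqrtr // lerDl; exact: sqr_ge0.
Qed.

Lemma archi_recip (R : realType) (eps : R) N : 0 < eps ->
  exists k, [/\ (N <= k)%N, (0 < k)%N & k%:R^-1 < eps].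
Proof.
move=> e0; have := archi_boundP (ltW (_ : 0 < eps^-1)); rewrite invr_gt0 => /(_ e0) H.
exists (maxn N.+1 (Num.bound eps^-1)); split.
- by rewrite (leq_trans (leqnSn N)) ?leq_maxl.
- by rewrite (leq_trans _ (leq_maxl _ _)).
rewrite invf_plt ?posrE ?ltr0n //; last by rewrite (leq_trans _ (leq_maxl _ _)).
by rewrite (lt_le_trans H) // ler_nat leq_maxr.
Qed.

Lemma horner_root0_bound (R : realType) (q : {poly R[i]}) : q.[0] = 0 ->
  exists2 B : R, 0 <= B & forall t : R, 0 <= t <= 1 ->
    `|q.[real_complex R t]| <= real_complex R (B * t).
Proof.
move=> /eqP/factor_theorem[q1 qE]; rewrite subr0 in qE.
exists (\sum_(j < size q1) complex.Re `|q1`_j|).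
  by apply: sumr_ge0 => j _; apply: le_trans (Re_le_norm _); rewrite normr_ge0.
move=> t /andP[t0 t1]; rewrite qE hornerM hornerX normrM rmorphM /=.
have nt : `|real_complex R t| = real_complex R t.
  by rewrite normc_def /= expr0n addr0 sqrtr_sqr ger0_norm.
rewrite nt ler_wpM2r //; first by rewrite -[0]/(real_complex R 0) lecR.
rewrite horner_coef (le_trans (ler_norm_sum _ _ _)) // rmorph_sum /=.
apply: ler_sum => j _; rewrite -norm_complexE normrM ler_piMr //.
by rewrite normrX nt -rmorphXn -[1]/(real_complex R 1) lecR exprn_ile1.
Qed.

Lemma norm_real_complex (R : realType) (x : R) :
  `|real_complex R x| = real_complex R `|x|.
Proof. by rewrite normc_def /= expr0n addr0 sqrtr_sqr. Qed.

(** One half of [u] absorbs [t w], the other half absorbs [a u]. *)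
Lemma cone_perturb (R : realType) (m : nat) (C : set 'rV[R]_m.+1) u w (t a : R) :
  open_convex_cone C -> C u -> `|a| < 2^-1 -> C (2^-1 *: u + t *: w) ->
  C (u + t *: w + a *: u).
Proof.
move=> coneC Cu; rewrite ltr_norml => /andP[a1 _] Cw.
have -> : u + t *: w + a *: u = (2^-1 *: u + t *: w) + (2^-1 + a) *: u.
  by apply/rowP => j; rewrite !mxE; lra.
by apply: coneD => //; apply: coneZ => //; lra.
Qed.

Lemma complex_line_pointE (K : comNzRingType) (n : nat) (u y v w : 'rV[K]_n) (j l a b : K) :
  u + j *: y + l *: (v + j *: w) + (a + j * b) *: u =
  u + l *: v + a *: u + j *: (y + l *: w + b *: u).
Proof. by apply/rowP => k; rewrite !mxE; ring. Qed.

(** On the line through [z + w / k] in the direction [u], the restriction of [p] has the fixed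
    leading coefficient [p(u)] and a small value at 0, hence a root [t] of norm less than 1/2; this
    is small enough to stay in the tube. *)
Lemma tube_root_near (R : realType) (m d : nat) (C : set 'rV[R]_m.+1)
    (p : mpoly m.+1 R) (u y : 'rV[R]_m.+1) (w : 'rV[R[i]]_m.+1) N :
  open_convex_cone C -> homog d p -> evalp p u != 0 -> C u ->
  let z := toC u + 'i%C *: toC y in
  evalp (complexp p) z = 0 ->
  exists k u' y' (t : R[i]), [/\ (N <= k)%N, C u',
    z + k%:R^-1 *: w + t *: toC u = toC u' + 'i%C *: toC y' &
    evalp (complexp p) (toC u' + 'i%C *: toC y') = 0].
Proof.
move=> coneC pd pu Cu z pz.
have [w1 [w2 wE]] := complex_rowE w.
have [oC _ _] := coneC.
have Cu2 : C ((2^-1 : R) *: u) by apply: coneZ => //; rewrite invr_gt0.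
have [e e0 eC] := open_segment w1 oC Cu2.
have q0 : (mline z w (complexp p)).[0] = 0.
  by rewrite horner_mline scale0r addr0.
have [B B0 BP] := horner_root0_bound q0.
pose c := `|evalp p u| * 2^-1 ^+ d.
have c0 : 0 < c by rewrite mulr_gt0 ?normr_gt0 // exprn_gt0 // invr_gt0.
(* The three demands on [1 / k]: [u / 2 + w1 / k] stays in [C]; the linear bound by [B] holds on the
   unit interval only; and the value at 0 is below the threshold [c] of [small_root] for
   [eps = 1 / 2]. *)
have e'0 : 0 < Num.min e (Num.min 1 (c / (1 + B))).
  by rewrite !lt_min e0 ltr01 divr_gt0 // ltr_pwDl.
have [k [Nk k0]] := archi_recip N e'0.
rewrite !lt_min => /and3P[ke k1 kc].
pose t0 : R := k%:R^-1; have t00 : 0 < t0 by rewrite invr_gt0 ltr0n.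
have t0E : k%:R^-1 = real_complex R t0 by rewrite fmorphV rmorph_nat.
pose T := mline (z + k%:R^-1 *: w) (toC u) (complexp p).
have pcu : evalp (complexp p) (toC u) = real_complex R (evalp p u).
  exact: evalp_complexp.
have [Td Tl] : size T = d.+1 /\ lead_coef T = real_complex R (evalp p u).
  rewrite -pcu; apply: size_mline; first exact: homog_complexp.
  by rewrite pcu fmorph_eq0.
have T0 : `|T.[0]| < `|lead_coef T| * (real_complex R 2^-1) ^+ d.
  have -> : T.[0] = (mline z w (complexp p)).[real_complex R t0].
    by rewrite !horner_mline scale0r addr0 t0E.
  have t0P : 0 <= t0 <= 1 by rewrite ltW //= ltW.
  apply: le_lt_trans (BP t0 t0P) _; rewrite Tl norm_real_complex.
  rewrite -(rmorphXn (real_complex R)) -(rmorphM (real_complex R)) ltcR.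
  rewrite ltr_pdivlMr ?ltr_pwDl // in kc.
  by apply: le_lt_trans kc; rewrite mulrC ler_wpM2l ?(ltW t00) // lerDr.
have half0 : 0 <= real_complex R 2^-1 by rewrite -[0]/(real_complex R 0) lecR invr_ge0.
have [t Tt th] := small_root Td half0 T0.
have ht : `|complex.Re t| < 2^-1.
  apply: le_lt_trans (Re_le_norm t) _.
  by move: th; rewrite norm_complexE ltcR.
exists k, (u + t0 *: w1 + complex.Re t *: u), (y + t0 *: w2 + complex.Im t *: u), t.
have E : z + k%:R^-1 *: w + t *: toC u =
  toC (u + t0 *: w1 + complex.Re t *: u) + 'i%C *: toC (y + t0 *: w2 + complex.Im t *: u).
  rewrite !toC_D !toC_Z t0E /z wE {1}[t]complexE.
  exact: complex_line_pointE.
split; [exact: Nk | | exact: E | by rewrite -E -horner_mline].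
apply: (cone_perturb coneC Cu ht); apply: eC.
by rewrite gtr0_norm.
Qed.

Lemma evalm_complexp (R : realType) (n : nat) (z : 'rV[R[i]]_n) (p : mpoly n R) :
  evalm (real_complex R) z p = evalp (complexp p) z.
Proof. exact: esym (evalp_map _ _ _). Qed.

(** The displaced zero of [p] is again a zero of [g]; with [s] nonzero at the base point, the common
    divisor must vanish there, which a unit cannot do. *)
Lemma tube_nonzero (R : realType) (m d : nat) (C : set 'rV[R]_m.+1)
    (p g : mpoly m.+1 R) :
  open_convex_cone C -> homog d p -> (forall x, C x -> evalp p x != 0) ->
  coprimep_mpoly p g ->
  (forall u y, C u -> evalp (complexp p) (toC u + 'i%C *: toC y) = 0 ->
     evalp (complexp g) (toC u + 'i%C *: toC y) = 0) ->
  forall u y, C u -> evalp (complexp p) (toC u + 'i%C *: toC y) != 0.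
Proof.
move=> coneC pd pC pg common u y Cu; apply/eqP => pz.
have p0 : p != 0.
  by apply: contraNneq (pC u Cu) => ->; rewrite -mpolyC0 evalpC.
have [dl [s [s0 [a pE] [b gE] sP]]] := mpoly_bezout u g p0.
have dlU := pg _ _ _ pE gE.
have sC0 : complexp s != 0 by apply: contraNneq s0 => sC0; rewrite (complexp_eq0 sC0).
set z := toC u + _ in pz.
have [w [N wN]] := mpoly_nonvanishing z sC0.
have [k [u' [y' [t [Nk Cu' E pz']]]]] := tube_root_near w N coneC pd (pC u Cu) Cu pz.
have gz' := common _ _ Cu' pz'.
pose z2 := z + k%:R^-1 *: w + t *: toC u.
have ev h : evalm (real_complex R) z2 h = evalp (complexp h) (toC u' + 'i%C *: toC y').
  rewrite -E; exact: evalm_complexp.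
have [sz|dz] := sP _ _ _ _ (etrans (ev p) pz') (etrans (ev g) gz').
  have /negP := wN k Nk; apply; apply/eqP.
  exact: etrans (esym (evalm_complexp _ s)) sz.
have := rmorph_unit (evalm (real_complex R) z2) dlU.
by rewrite [X in X \is a _]dz unitr0.
Qed.

(** * Hyperbolicity, and how lines leave a cone *)

Lemma imaginary_scaleE (K : comNzRingType) (n : nat) (e x : 'rV[K]_n) (i0 a b : K) :
  i0 * i0 = -1 ->
  (- i0 * b) *: ((a + i0 * b) *: e + x) =
  (b * b) *: e + i0 *: (- ((a * b) *: e + b *: x)).
Proof.
move=> ii; apply/rowP => k; rewrite !mxE.
transitivity (- i0 * (b * a * e 0 k + b * x 0 k) - (i0 * i0) * (b * b * e 0 k)); first ring.
by rewrite ii; ring.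
Qed.

(** For a root [t = a + i b] with [b != 0], multiplying [t e + x] by [- i b] gives it the real part
    [b^2 e], which lies in [C]; by homogeneity it would be a zero of [p] in the tube. *)
Lemma tube_hyperbolic (R : realType) (m d : nat) (C : set 'rV[R]_m.+1)
    (p : mpoly m.+1 R) (e : 'rV[R]_m.+1) :
  open_convex_cone C -> homog d p -> C e -> 0 < evalp p e ->
  (forall u y, C u -> evalp (complexp p) (toC u + 'i%C *: toC y) != 0) ->
  hyperbolic p e.
Proof.
move=> coneC pd Ce pe pC; split=> //; first by exists d.
move=> x t pt; apply: contrapT => /eqP b0.
set a := complex.Re t; set b := complex.Im t in b0.
have tE : t = real_complex R a + 'i%C * real_complex R b by exact: complexE.
have Cb : C ((b * b) *: e).
  by apply: coneZ => //; rewrite -expr2 lt_neqAle eq_sym sqrf_eq0 b0 sqr_ge0.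
have ii : ('i%C : R[i]) * 'i%C = -1 by rewrite -expr2 sqr_i.
have := pC _ (- ((a * b) *: e + b *: x)) Cb; rewrite toC_Z toC_N toC_D !toC_Z.
have -> : real_complex R (b * b) = real_complex R b * real_complex R b.
  exact: rmorphM.
have -> : real_complex R (a * b) = real_complex R a * real_complex R b.
  exact: rmorphM.
rewrite -(imaginary_scaleE _ _ _ _ ii) -tE.
by rewrite (evalp_homog _ _ (homog_complexp pd)) pt mulr0 eqxx.
Qed.

(** Adding positive multiples of [e] preserves [C], so the parameters inside [C] form an up-set of
    the range above [a]. Its infimum gives a limit of [C], which openness keeps outside [C]. *)
Lemma cone_boundary_crossing (R : realType) (m : nat) (C : set 'rV[R]_m.+1)
    (e x : 'rV[R]_m.+1) (a b : R) :
  open_convex_cone C -> C e -> a <= b -> C (x + b *: e) -> ~ C (x + a *: e) ->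
  exists t, [/\ a <= t <= b, closure C (x + t *: e) & ~ C (x + t *: e)].
Proof.
move=> coneC Ce ab Cb Ca.
have [oC _ _] := coneC.
pose A := [set t | a <= t /\ C (x + t *: e)].
have Ab : A b by [].
have lA : lbound A a by move=> s [].
have hA : has_inf A by split; [exists b | exists a].
pose t := inf A.
have at_ : a <= t by apply: lb_le_inf => //; exists b.
have infA s : A s -> t <= s by move=> As; apply: ge_inf => //; exists a.
have Ct s : t < s -> C (x + s *: e).
  move=> ts; have st0 : 0 < s - t by rewrite subr_gt0.
  have [r [_ Cr]] := inf_adherent st0 hA; rewrite -/t addrC subrK => rs.
  have -> : x + s *: e = (x + r *: e) + (s - r) *: e.
    by rewrite -addrA -scalerDl [r + _]addrC subrK.
  by apply: coneD => //; apply: coneZ => //; rewrite subr_gt0.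
exists t; split; first by rewrite at_ infA.
- move=> B /nbhs_interior; rewrite nbhsE => -[U [oU Ux] UB].
  have [r r0 rU] := open_segment e oU Ux.
  have r20 : 0 < r / 2 by rewrite divr_gt0.
  exists (x + (t + r / 2) *: e); split; first by apply: Ct; rewrite ltrDl.
  apply: interior_subset; apply: UB; rewrite scalerDl addrA; apply: rU.
  by rewrite gtr0_norm // ltr_pdivrMr // ltr_pMr // ltr1n.
- move=> Cxt; have [r r0 rC] := open_segment e oC Cxt.
  have ta : a < t by rewrite lt_neqAle at_ andbT; apply/eqP => ta; apply: Ca; rewrite ta.
  (* The maximum keeps [s] in the range of [A]; [s < t] relies on [a < t]. *)
  pose s := Num.max a (t - r / 2).
  have r20 : 0 < r / 2 by rewrite divr_gt0.
  have st : s < t by rewrite gt_max ta ltrBlDr ltrDl.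
  have ts : t - r / 2 <= s by rewrite le_max lexx orbT.
  have : A s.
    split; first by rewrite le_max lexx.
    have -> : x + s *: e = (x + t *: e) + (s - t) *: e.
      by rewrite -addrA -scalerDl [t + _]addrC subrK.
    apply: rC.
    by rewrite ltr0_norm ?subr_lt0 //; lra.
  by move=> /infA; rewrite leNgt st.
Qed.
(** * Polynomials vanishing on the boundary of a cone *)

Lemma continuous_evalp (R : realType) (m : nat) (p : mpoly m.+1 R) :
  continuous (fun x : 'rV[R]_m.+1 => evalp p x : R).
Proof.
elim/mpoly_ring_ind: p => [c|j|p q IHp IHq|p q IHp IHq].
- have -> : (fun y : 'rV[R]_m.+1 => evalp c%:MP y) = cst c.
    by apply/funext => y; rewrite evalpC.
  exact: cst_continuous.
- have -> : (fun y : 'rV[R]_m.+1 => evalp 'X_j y) = (fun y => y 0 j).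
    by apply/funext => y; rewrite evalpXU.
  exact: coord_continuous.
- have -> : (fun y : 'rV[R]_m.+1 => evalp (p + q) y) =
      (fun y => evalp p y + evalp q y).
    by apply/funext => y; rewrite evalpD.
  by move=> x; apply: continuousD; [exact: IHp | exact: IHq].
- have -> : (fun y : 'rV[R]_m.+1 => evalp (p * q) y) =
      (fun y => evalp p y * evalp q y).
    by apply/funext => y; rewrite evalpM.
  by move=> x; apply: continuousM; [exact: IHp | exact: IHq].
Qed.

(** The origin is removed: it is a limit of any nonempty cone but no point of projective space. *)
Definition cone_boundary (R : realType) (m : nat) (C : set 'rV[R]_m.+1) :
  set 'rV[R]_m.+1 := [set x | [/\ x != 0, closure C x & ~ C x]].

Definition vanishes_on (R : realType) (m : nat) (B : set 'rV[R]_m.+1)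
  (p : mpoly m.+1 R) : Prop := forall x, B x -> evalp p x = 0.

Lemma displacement_lt (R : realFieldType) (r l t W E : R) :
  0 <= W -> 0 <= E -> 0 < l -> l < r / 2 / (1 + W) -> t <= r / 2 / (1 + E) ->
  0 <= t -> l * W + t * E < r.
Proof.
move=> W0 E0 l0; rewrite ltr_pdivlMr ?ltr_pwDl // => lW.
rewrite ler_pdivlMr ?ltr_pwDl // => tE t0.
have : t * E <= t * (1 + E) by rewrite ler_wpM2l // lerDr.
have : l * W <= l * (1 + W) by rewrite ler_wpM2l ?(ltW l0) // lerDr.
by lra.
Qed.

Section Boundary.
Variables (R : realType) (m : nat) (C : set 'rV[R]_m.+1) (e : 'rV[R]_m.+1).
Hypothesis coneC : open_convex_cone C.
Hypothesis Ce : C e.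

(** For [y'] near [y], [eta e + y - y'] lies in [C]; take [y'] in [C] and add. *)
Lemma closure_cone_inner y (eta : R) : closure C y -> 0 < eta -> C (y + eta *: e).
Proof.
move=> Cy eta0; have [oC _ _] := coneC.
have cf : {for y, continuous (cst (eta *: e + y) - (id : 'rV[R]_m.+1 -> 'rV[R]_m.+1))}.
  by apply: continuousB; [exact: cst_continuous | exact: cvg_id].
have : nbhs y [set y' | C (eta *: e + y - y')].
  apply: (cf C); apply: open_nbhs_nbhs; split=> //.
  change (C (eta *: e + y - y)).
  by rewrite addrK; apply: coneZ.
move=> /Cy[y' [Cy' Cd]].
by have := coneD coneC Cy' Cd; rewrite addrCA subrr addr0 addrC.
Qed.

(** If [d] were nonzero at a boundary point [y], it would be nonzero near [y]. But a nearby line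
    parallel to [e], with base point off [s = 0], meets the boundary close to [y], in a common zero
    of [p] and [g], hence a zero of [d]. *)
Lemma cone_boundary_gcd (p g : mpoly m.+1 R) : p != 0 ->
  vanishes_on (cone_boundary C) p -> vanishes_on (cone_boundary C) g ->
  exists d, [/\ divides d p, divides d g & vanishes_on (cone_boundary C) d].
Proof.
move=> p0 pB gB; have [d [s [s0 dp dg sP]]] := mpoly_bezout e g p0.
exists d; split=> // y [y0 Cy nCy]; apply: contrapT => /eqP dy.
have [oC _ _] := coneC.
have [w [N wN]] := mpoly_nonvanishing y s0.
have : nbhs y [set x | x != 0 /\ evalp d x != 0].
  apply: filterI.
    apply/nbhs_ballP; exists `|y|; first by rewrite /= normr_gt0.
    move=> x; rewrite -ball_normE /=; apply: contraTneq => ->.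
    by rewrite subr0 ltxx.
  apply: (@continuous_evalp _ _ d y [set t | t != 0]).
  by apply: open_nbhs_nbhs; split=> //; exact: (@open_neq _ 0).
move=> /nbhs_ballP[r /= r0 rP].
pose eta := r / 2 / (1 + `|e|).
have eta0 : 0 < eta by rewrite !divr_gt0 // ltr_pwDl.
(* [y + eta e] lies in [C] and [y - eta e] off its closure; both conditions are open and survive the
   shift by [w / k], so a crossing remains between them. *)
have Cin := closure_cone_inner Cy eta0.
have [e1 e10 e1P] := open_segment w oC Cin.
have Cout : (~` closure C) (y - eta *: e).
  move=> /closure_cone_inner /(_ eta0); rewrite subrK; exact: nCy.
have oCc : open (~` closure C) by apply: closed_openC; exact: closed_closure.
have [e2 e20 e2P] := open_segment w oCc Cout.
have e30 : 0 < Num.min e1 (Num.min e2 (r / 2 / (1 + `|w|))).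
  by rewrite !lt_min e10 e20 !divr_gt0 // ltr_pwDl.
have [k [Nk k0]] := archi_recip N e30; rewrite !lt_min => /and3P[ke1 ke2 ke3].
have k0' : 0 < k%:R^-1 :> R by rewrite invr_gt0 ltr0n.
set l : R := k%:R^-1 in ke1 ke2 ke3 k0'.
have C1 : C ((y + l *: w) + eta *: e).
  by rewrite addrAC; apply: e1P; rewrite gtr0_norm.
have C2 : ~ C ((y + l *: w) + (- eta) *: e).
  move=> /subset_closure; rewrite scaleNr addrAC; apply: e2P.
  by rewrite gtr0_norm.
have eta2 : - eta <= eta by lra.
have [t [/andP[t1 t2] bC bnC]] := cone_boundary_crossing coneC Ce eta2 C1 C2.
have [b0 db] : y + l *: w + t *: e != 0 /\ evalp d (y + l *: w + t *: e) != 0.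
  apply: rP; rewrite -ball_normE /=.
  rewrite -addrA opprD addrA subrr add0r normrN.
  apply: le_lt_trans (ler_normD _ _) _; rewrite !normrZ (gtr0_norm k0').
  apply: (displacement_lt (normr_ge0 w) (normr_ge0 e) k0' ke3 _ (normr_ge0 t)).
  by rewrite -/eta ler_norml t1.
have bB : cone_boundary C (y + l *: w + t *: e) by split.
have := sP R idfun (y + l *: w) t.
rewrite (_ : map_mx idfun e = e); last by apply/rowP => j; rewrite mxE.
move=> /(_ (pB _ bB) (gB _ bB))[sz|dz].
  by have /negP := wN k Nk; apply; apply/eqP; exact: sz.
by move/eqP: db; apply; exact: dz.
Qed.

(** A common divisor of the minimal [q] and of [g] still vanishes on the boundary; minimality makes
    its cofactor in [q] constant. *)
Lemma vanishing_generator (p : mpoly m.+1 R) : p != 0 ->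
  vanishes_on (cone_boundary C) p ->
  exists q, [/\ divides q p, vanishes_on (cone_boundary C) q &
    forall g, vanishes_on (cone_boundary C) g -> divides q g].
Proof.
move=> p0 pB.
pose Q k := exists q, [/\ divides q p, vanishes_on (cone_boundary C) q & msize q = k].
have Qp : exists k, `[< Q k >].
  by exists (msize p); apply/asboolP; exists p; split=> //; exact: divides_refl.
have [k /asboolP[q [qp qB qk]] kmin] := ex_minnP Qp.
exists q; split=> // g gB.
have q0 : q != 0 by apply: contraNneq p0 => q0; case: qp => c ->; rewrite q0 mulr0.
have [d [dq dg dB]] := cone_boundary_gcd q0 qB gB.
have qd : (msize q <= msize d)%N.
  rewrite qk; apply: kmin; apply/asboolP; exists d; split=> //.
  exact: divides_trans qp.
have [a qE] := dq.
have a0 : a != 0 by apply: contraNneq q0 => a0; rewrite qE a0 mul0r.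
have d0 : d != 0 by apply: contraNneq q0 => d0; rewrite qE d0 mulr0.
have sa : (msize a <= 1)%N.
  move: qd; rewrite qE msizeM //.
  have : (0 < msize d)%N by rewrite lt0n msize_poly_eq0.
  move: (mmeasure _ a) (mmeasure _ d) => k1 k2; lia.
have aC := msize1_polyC sa.
set c := mcoeff mnm0 a in aC.
have c0 : c != 0 by apply: contraNneq a0 => c0; rewrite aC c0 mpolyC0.
case: dg => b ->; exists (b * c^-1%:MP).
by rewrite qE aC -mulrA [_ * (_ * d)]mulrA -mpolyCM mulVf // mul1r.
Qed.

End Boundary.
Lemma mul_imaginaryE (A : comNzRingType) (i0 x1 x2 y1 y2 : A) : i0 * i0 = - 1 ->
  (x1 + i0 * x2) * (y1 + i0 * y2) = x1 * y1 - x2 * y2 + i0 * (x1 * y2 + x2 * y1).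
Proof.
move=> ii; transitivity (x1 * y1 + i0 * i0 * (x2 * y2) + i0 * (x1 * y2 + x2 * y1)); first ring.
by rewrite ii mulN1r.
Qed.

Lemma complex_mpolyE (R : realType) (n : nat) (h : mpoly n R[i]) :
  exists h1 h2 : mpoly n R, h = complexp h1 + ('i%C)%:MP * complexp h2.
Proof.
have cC c : complexp c%:MP = (real_complex R c)%:MP :> mpoly n R[i].
  by rewrite /complexp map_mpolyC.
have cD f g : complexp (f + g) = complexp f + complexp g :> mpoly n R[i].
  exact: rmorphD.
have cM f g : complexp (f * g) = complexp f * complexp g :> mpoly n R[i].
  exact: rmorphM.
have cN f : complexp (- f) = - complexp f :> mpoly n R[i].
  exact: rmorphN.
elim/mpoly_ring_ind: h => [c|j|f g [f1 [f2 ->]] [g1 [g2 ->]]|f g [f1 [f2 ->]] [g1 [g2 ->]]].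
- exists (complex.Re c)%:MP, (complex.Im c)%:MP.
  by rewrite !cC -mpolyCM -mpolyCD -complexE.
- have c0 : complexp 0 = 0 :> mpoly n R[i] by exact: rmorph0.
  exists 'X_j, 0; rewrite c0 mulr0 addr0.
  by rewrite /complexp map_mpolyX.
- exists (f1 + g1), (f2 + g2); rewrite (cD f1) (cD f2).
  by rewrite mulrDr addrACA.
- exists (f1 * g1 - f2 * g2), (f1 * g2 + f2 * g1).
  rewrite (cD (f1 * g1)) (cN (f2 * g2)) (cD (f1 * g2)) (cM f1) (cM f2) (cM f1) (cM f2).
  have ii : ('i%C)%:MP * ('i%C)%:MP = - 1 :> mpoly n R[i].
    by rewrite -mpolyCM -expr2 sqr_i mpolyCN mpolyC1.
  by move: (complexp f1) (complexp f2) (complexp g1) (complexp g2) => x1 x2 y1 y2;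
     exact: mul_imaginaryE ii.
Qed.

(** At a real point [h] vanishes only if its real and imaginary parts do, so divisibility over the
    reals controls complex polynomials too. *)
Lemma zariski_vanishing (R : realType) (n : nat) (B : set 'rV[R]_n)
    (q : mpoly n R) :
  (forall g, (forall x, B x -> evalp g x = 0) -> divides q g) ->
  forall h : mpoly n R[i], (forall x, B x -> evalp h (toC x) = 0) ->
  forall z, evalp (complexp q) z = 0 -> evalp h z = 0.
Proof.
move=> qB h hB z qz; have [h1 [h2 hE]] := complex_mpolyE h.
have [h1B h2B] : (forall x, B x -> evalp h1 x = 0) /\ (forall x, B x -> evalp h2 x = 0).
  suff H x : B x -> evalp h1 x = 0 /\ evalp h2 x = 0 by split=> x /H[].
  have E : evalp h (toC x) = real_complex R (evalp h1 x) + 'i%C * real_complex R (evalp h2 x).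
    rewrite hE; apply: etrans (evalpD _ _ _) _; congr (_ + _).
      exact: evalp_complexp.
    apply: etrans (evalpM _ _ _) _; congr (_ * _); first exact: evalpC.
    exact: evalp_complexp.
  move=> /hB; rewrite E => /eqP.
  by rewrite eq_complex /= !(mul0r, mul1r, mulr0, addr0, subr0, add0r) => /andP[/eqP -> /eqP ->].
have dz g : divides q g -> evalp (complexp g) z = 0.
  move=> [c ->]; have -> : complexp (c * q) = complexp c * complexp q by exact: rmorphM.
  by apply: etrans (evalpM _ _ _) _; rewrite [X in _ * X]qz mulr0.
have d1 := dz _ (qB _ h1B); have d2 := dz _ (qB _ h2B).
rewrite hE; apply: etrans (evalpD _ _ _) _; rewrite [X in X + _]d1 add0r.
by apply: etrans (evalpM _ _ _) _; rewrite [X in _ * X]d2 mulr0.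
Qed.

(** * Irreducible components *)

Section Zariski.
Variables (R : realType) (n : nat).
Implicit Types A B D Y Z : set 'rV[R[i]]_n.

Lemma zariski_closure_sub A : A `<=` @projective_space R n -> A `<=` zariski_closure A.
Proof. by move=> An z Az; split=> [|d p pd pA]; [exact: An | exact: pA]. Qed.

Lemma zariski_closureS A B : A `<=` B -> zariski_closure A `<=` zariski_closure B.
Proof. by move=> AB z [z0 zA]; split=> // d p pd pB; apply: zA pd _ => a /AB /pB. Qed.

Lemma zariski_closed_min A Z : zariski_closed Z -> A `<=` Z -> zariski_closure A `<=` Z.
Proof. by move=> cZ AZ; rewrite -[X in _ `<=` X]cZ; exact: zariski_closureS. Qed.

Lemma zariski_closed_nonzero Z : zariski_closed Z -> Z `<=` @projective_space R n.
Proof. by move=> <- z []. Qed.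

Lemma zariski_closure_closed A : zariski_closed (zariski_closure A).
Proof.
apply/seteqP; split; last by apply: zariski_closure_sub => z [].
move=> z [z0 zA]; split=> // d p pd pA; apply: (zA d p pd) => a [_ aP].
exact: aP pd pA.
Qed.

Lemma zariski_closedI Y Z : zariski_closed Y -> zariski_closed Z -> zariski_closed (Y `&` Z).
Proof.
move=> cY cZ; apply/seteqP; split.
  by rewrite subsetI; split; apply: zariski_closed_min => // z [].
by apply: zariski_closure_sub => z [/(zariski_closed_nonzero cY)].
Qed.

Lemma irreducible_cover Y Z D : irreducible_variety D -> zariski_closed Y ->
  zariski_closed Z -> D `<=` Y `|` Z -> D `<=` Y \/ D `<=` Z.
Proof.
move=> [_ cD iD] cY cZ DYZ.
have : D = (D `&` Y) `|` (D `&` Z) by rewrite -setIUr; apply/esym/setIidPl.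
by move=> /(iD _ _ (zariski_closedI cD cY) (zariski_closedI cD cZ))[->|->]; [left|right] => z [].
Qed.

Lemma irreducible_point (z : 'rV[R[i]]_n) : z != 0 -> irreducible_variety (zariski_closure [set z]).
Proof.
move=> z0; have zz : zariski_closure [set z] z by apply: zariski_closure_sub => // _ ->.
split; [by exists z | exact: zariski_closure_closed |] => Y Z cY cZ YZ.
have : (Y `|` Z) z by rewrite -YZ.
have sub W : W `<=` Y `|` Z -> zariski_closed W -> W z -> zariski_closure [set z] = W.
  move=> WYZ cW Wz; apply/seteqP; split; last by rewrite YZ.
  by apply: zariski_closed_min => // _ ->.
by case=> [Yz|Zz]; [left; apply: sub => // ? ?; left | right; apply: sub => // ? ?; right].
Qed.

(** If a member [D1] is not inside [Y], it is inside [Z]; so are the smaller members, and the larger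
    ones are not inside [Y] either. *)
Lemma irreducible_chain_union (F : set (set 'rV[R[i]]_n)) :
  F !=set0 -> (forall D, F D -> irreducible_variety D) -> total_on F subset ->
  irreducible_variety (zariski_closure (\bigcup_(D in F) D)).
Proof.
move=> [D0 FD0] Fi Ftot.
have Fn : \bigcup_(D in F) D `<=` @projective_space R n.
  by move=> z [D FD Dz]; have [_ cD _] := Fi D FD; exact: (zariski_closed_nonzero cD).
have FS := zariski_closure_sub Fn.
split; [|exact: zariski_closure_closed|].
  by have [[z D0z] _ _] := Fi D0 FD0; exists z; apply: FS; exists D0.
move=> Y Z cY cZ YZ.
have FYZ D : F D -> D `<=` Y \/ D `<=` Z.
  move=> FD; apply: irreducible_cover (Fi D FD) cY cZ _; rewrite -YZ.
  by move=> z Dz; apply: FS; exists D.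
have sub W : zariski_closed W -> W `<=` Y `|` Z -> (forall D, F D -> D `<=` W) ->
    zariski_closure (\bigcup_(D in F) D) = W.
  move=> cW WYZ FW; apply/seteqP; split; last by rewrite YZ.
  by apply: zariski_closed_min => // z [D FD Dz]; exact: FW Dz.
have [allY|/existsNP[D1 /not_implyP[FD1 D1Y]]] := pselect (forall D, F D -> D `<=` Y).
  by left; apply: sub => // ? ?; left.
right; apply: sub => [//|? ?|D FD]; first by right.
have [//|D1Z] := FYZ D1 FD1.
have [DD1|D1D] := Ftot D D1 FD FD1; first exact: subset_trans D1Z.
have [DY|//] := FYZ D FD.
by case: D1Y; exact: subset_trans DY.
Qed.

(** Zorn's lemma on the irreducible closed subsets of [B] through [z], starting from the closure of
    [z]. A component through a prescribed point is what the pole condition will be tested on. *)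
Lemma exists_irreducible_component B z : zariski_closed B -> B z ->
  exists2 D, irreducible_component B D & D z.
Proof.
move=> cB Bz; have z0 : z != 0 by exact: (zariski_closed_nonzero cB).
pose Q (D : set 'rV[R[i]]_n) := [/\ irreducible_variety D, D `<=` B & D z].
pose T := {D | Q D}.
have pt : T.
  exists (zariski_closure [set z]); split; first exact: irreducible_point.
    by apply: zariski_closed_min => // _ ->.
  by apply: zariski_closure_sub => // _ ->.
pose r (s t : T) := `[< sval s `<=` sval t >].
have svalI (s t : T) : sval s = sval t -> s = t.
  by case: s t => [s sP] [t tP] /= st; subst t; congr exist; exact: Prop_irrelevance.
have [||||D Dmax] := @Zorn T r.
- by move=> s; apply/asboolP; exact: subset_refl.
- by move=> s t u /asboolP st /asboolP tu; apply/asboolP; exact: subset_trans tu.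
- by move=> s t /asboolP st /asboolP ts; apply: svalI; apply/seteqP.
- move=> A Atot.
  have [[s0 As0]|A0] := pselect (A !=set0); last first.
    by exists pt => s As; case: A0; exists s.
  pose F := [set D | exists2 s, A s & sval s = D].
  have Fi : irreducible_variety (zariski_closure (\bigcup_(D in F) D)).
    apply: irreducible_chain_union; first by exists (sval s0), s0.
      by move=> _ [s _ <-]; case: (svalP s).
    move=> _ _ [s As <-] [t At <-].
    by have [/asboolP|/asboolP] := Atot s t As At; [left|right].
  have FB : zariski_closure (\bigcup_(D in F) D) `<=` B.
    apply: zariski_closed_min => // y [_ [s _ <-]]; case: (svalP s) => _ sB _; exact: sB.
  have FS : \bigcup_(D in F) D `<=` zariski_closure (\bigcup_(D in F) D).
    apply: zariski_closure_sub => y [_ [s _ <-]].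
    by case: (svalP s) => -[_ cs _] _ _; exact: (zariski_closed_nonzero cs).
  have Fz : zariski_closure (\bigcup_(D in F) D) z.
    by apply: FS; exists (sval s0); [exists s0 | case: (svalP s0)].
  exists (exist Q _ (And3 Fi FB Fz)) => s As; apply/asboolP => y sy; apply: FS.
  by exists (sval s) => //; exists s.
have [Di DB Dz] := svalP D.
exists (sval D) => //; split=> // E Ei DE EB.
have Ez : E z by exact: DE.
have DEr : r D (exist Q E (And3 Ei EB Ez)) by apply/asboolP.
by have /(congr1 sval) := Dmax _ DEr.
Qed.

End Zariski.
(** * Poles of the canonical form *)

Lemma diffpE (K : comNzRingType) (n : nat) (p : mpoly n K) z v :
  diffp p z v = evalp (mdird v p) z.
Proof.
rewrite /diffp /mdird /evalp raddf_sum; apply: eq_bigr => k _.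
by rewrite /= mevalZ mulrC.
Qed.

(* Homogeneous coordinates: the quotients [x_l / x_j], for [l != j], are affine
   coordinates on [x_j != 0]. *)
Lemma det_affine_coordinates (K : fieldType) (m : nat) (z : 'rV[K]_m.+1)
    (V : 'M[K]_(m, m.+1)) (j : 'I_m.+1) : z 0 j != 0 ->
  \det (\matrix_(i0 < m, k < m)
    ((V i0 (lift j k) * z 0 j - z 0 (lift j k) * V i0 j) / z 0 j ^+ 2)) =
  (-1) ^+ j * \det (col_mx z V : 'M[K]_m.+1) / z 0 j ^+ m.+1.
Proof.
move=> zj.
pose c : 'cV[K]_m := \col_k (V k j / z 0 j).
(* [L] subtracts from each row of [V] the multiple of [z] that clears its entry in column [j];
   expansion along that column leaves the chart determinant. *)
pose L : 'M[K]_(1 + m) := block_mx 1%:M 0 (- c) 1%:M.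
pose A : 'M[K]_(1 + m) := L *m (col_mx z V : 'M[K]_(1 + m)).
have AE : A = col_mx z (V - c *m z).
  by rewrite /A /L mul_block_col mul1mx mul0mx addr0 mul1mx mulNmx addrC.
have detA : \det A = \det (col_mx z V : 'M[K]_(1 + m)).
  by rewrite det_mulmx det_lblock !det1 !mul1r.
set M := \matrix_(_, _) _.
have liftE (k : 'I_m) : lift ord0 k = rshift 1 k :> 'I_(1 + m) by apply: val_inj.
have AM (k : 'I_m) (l : 'I_m) : A (lift ord0 k) (lift j l) = z 0 j * M k l.
  rewrite AE liftE col_mxEd !mxE big_ord1 !mxE.
  by field.
have A0 : A 0 j = z 0 j.
  have E0 : (0 : 'I_(1 + m)) = lshift m (0 : 'I_1) by apply: val_inj.
  by rewrite AE E0 col_mxEu.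
have Aj (k : 'I_m) : A (lift ord0 k) j = 0.
  rewrite AE liftE col_mxEd !mxE big_ord1 !mxE.
  by field.
have : \det A = z 0 j * ((-1) ^+ j * (z 0 j ^+ m * \det M)).
  rewrite (expand_det_col A j) big_ord_recl big1 ?addr0 => [|k _]; last first.
    by rewrite [X in X * _]Aj mul0r.
  rewrite A0 /cofactor add0n; congr (_ * (_ * _)).
  rewrite -detZ; congr (\det _); apply/matrixP => k l.
  by rewrite [LHS]mxE [LHS]mxE AM [RHS]mxE.
rewrite detA => ->.
have ss : (-1) ^+ j * (-1) ^+ j = 1 :> K by rewrite -expr2 sqrr_sign.
have zm : z 0 j ^+ m != 0 by rewrite expf_neq0.
move: ((-1) ^+ j) (\det M) (z 0 j ^+ m) zm ss (exprS (z 0 j) m) => s D Z Z0 ss ->.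
transitivity (s * s * D); first by rewrite ss mul1r.
by field; rewrite Z0 zj.
Qed.

Lemma chart_valueE (K : fieldType) (s t x y Z D : K) : s * s = 1 -> Z != 0 ->
  t * s * x * Z / y * (s * D / Z) = x / y * (t * D).
Proof.
move=> ss Z0; transitivity ((s * s) * (x / y * (t * D)) * (Z / Z)); first ring.
by rewrite ss mul1r mulfV // mulr1.
Qed.

Section PoleFreeForm.
Variables (R : realType) (m : nat) (q p : mpoly m.+1 R) (j : 'I_m.+1).

(** The form [(q / p) dx] in the chart [x_j != 0]. The factor [X_j ^ (m + 1)] gives the coefficient
    degree 0 and, with [(-1)^j], cancels the factors of [det_affine_coordinates]; [(-1)^m] is the
    sign of [canonical_fraction]. *)
Definition affine_form : mform R m.+1 m :=
  @MForm R m.+1 m 1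
    (fun _ => RatFun (((-1) ^+ m * (-1) ^+ j)%:MP * complexp q * 'X_j ^+ m.+1) (complexp p))
    (fun _ k => RatFun 'X_(lift j k) 'X_j).

Lemma form_eval_affine (z : 'rV[R[i]]_m.+1) V : z 0 j != 0 ->
  form_eval affine_form z V = evalp (complexp q) z / evalp (complexp p) z *
    ((-1) ^+ m * \det (col_mx z V : 'M[R[i]]_m.+1)).
Proof.
move=> zj; rewrite /form_eval /affine_form /= big_ord1 /=.
have -> : \matrix_(i0 < m, k < m) rdiff (RatFun 'X_(lift j k) 'X_j) z (row i0 V) =
  \matrix_(i0 < m, k < m)
    ((V i0 (lift j k) * z 0 j - z 0 (lift j k) * V i0 j) / z 0 j ^+ 2).
  apply/matrixP => i0 k; rewrite !mxE /rdiff /= !diffpE !mdirdXU !evalpXU !evalpC.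
  by rewrite !mxE.
rewrite det_affine_coordinates // /reval /=.
rewrite !evalpM evalpC.
have -> : evalp ('X_j ^+ m.+1) z = z 0 j ^+ m.+1.
  by rewrite /evalp rmorphXn /= mevalXU.
have zjm : z 0 j ^+ m.+1 != 0 by rewrite expf_neq0.
have ss : (-1) ^+ j * (-1) ^+ j = 1 :> R[i] by rewrite -expr2 sqrr_sign.
exact: chart_valueE ss zjm.
Qed.

End PoleFreeForm.

(** An element of the local ring is the root of a monic polynomial of degree 1 over it. *)
Lemma ratfun_integral_along (R : realType) (n : nat) (X Z : set 'rV[R[i]]_n) (f : ratfun R n) :
  Z `<=` X -> is_ratfun Z f -> integral_along X Z f.
Proof.
move=> ZX [[d [nd dd]] [z [Zz fz]]]; split.
  by split; [exists d | exists z; split=> //; exact: ZX].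
exists 1%N, (fun _ => RatFun (- rnum f) (rden f)); split=> [_|x _ _ _].
  split; last by exists z.
  by exists d; split=> //=; rewrite /homog rpredN.
by rewrite big_ord1 /reval /= evalpN expr1 expr0 mulr1 mulNr addrN.
Qed.

Lemma homogM (K : comNzRingType) (n d1 d2 : nat) (p q : mpoly n K) :
  homog d1 p -> homog d2 q -> homog (d1 + d2) (p * q).
Proof. exact: dhomogM. Qed.

Lemma homogXUn (K : comNzRingType) (n k : nat) (j : 'I_n) :
  homog k ('X_j ^+ k : mpoly n K).
Proof.
have X1 : ('X_j : mpoly n K) \is ishomog1 1 mdeg by rewrite dhomogX /= mdeg1.
by have := dhomogMn k X1; rewrite mul1n.
Qed.

Lemma regular_along_pole_free (R : realType) (m : nat) (w : mform R m.+1 m)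
    (q p : mpoly m.+1 R) (D : set 'rV[R[i]]_m.+1) (z : 'rV[R[i]]_m.+1) :
  (0 < m)%N -> canonical_fraction w q p -> D `<=` @projective_space R m.+1 ->
  D z -> evalp (complexp p) z != 0 ->
  regular_along (@projective_space R m.+1) D w.
Proof.
move=> m0 [[d [qd pd]] _ _ wE] Dn Dz pz.
have [j zj] : exists j, z 0 j != 0.
  apply: contrapT => /forallNP zj; have /negP := Dn _ Dz; apply.
  by apply/eqP/rowP => k; rewrite mxE; apply: contrapT => /eqP; exact: zj.
have hX k : homog 1 ('X_k : mpoly m.+1 R[i]) by exact: (homogXUn _ 1 k).
exists (affine_form q p j); split.
  split=> [k|k l] /=; apply: ratfun_integral_along => //.
    split; last by exists z.
    exists (d + m.+1)%N; split=> /=; last exact: homog_complexp.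
    apply: homogM; last exact: homogXUn.
    by rewrite mul_mpolyC; apply: dhomogZ; exact: homog_complexp.
  split; first by exists 1%N; split=> /=; exact: hX.
  by exists z; split=> //=; rewrite evalpXU.
move=> x V _ wx [w'x1 w'x2] _.
have px : evalp (complexp p) x != 0 := w'x1 ord0.
(* [0 < m] provides an argument of [affine_form], and that argument is defined only where
   [x_j != 0]. *)
have xj : x 0 j != 0 by have := w'x2 ord0 (Ordinal m0); rewrite /def_at /= evalpXU.
by rewrite (form_eval_affine _ _ _ xj); exact: wE.
Qed.

(** The clause on poles exists in positive dimension only, hence [m.+1]; dimension 0 is settled by
    [euclidean_boundary_line]. *)
Lemma canonical_denominator_boundary (R : realType) (m : nat) (P : set 'rV[R]_m.+2)
    (o : orientation R m.+2 m.+1) (w : mform R m.+2 m.+1) (q p : mpoly m.+2 R) :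
  Defs.canonical_form (@projective_space R m.+2) P o w -> canonical_fraction w q p ->
  forall x, euclidean_boundary (@projective_space R m.+2) P x -> evalp p x = 0.
Proof.
move=> [_ [_ [_ wD] _]] wf x xP; apply: contrapT => /eqP px.
have xB : algebraic_boundary (@projective_space R m.+2) P (toC x).
  apply: zariski_closure_sub; last by exists x.
  by move=> _ [y [[_ y0] _] <-].
have cB : zariski_closed (algebraic_boundary (@projective_space R m.+2) P).
  exact: zariski_closure_closed.
have [D DB Dx] := exists_irreducible_component cB xB.
have [[nreg _] _] := wD D DB; apply: nreg.
have [_ Dsub _] := DB.
apply: regular_along_pole_free wf _ Dx _ => //.
  exact: subset_trans Dsub (zariski_closed_nonzero cB).
have -> : evalp (complexp p) (toC x) = real_complex R (evalp p x).
  exact: evalp_complexp.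
by rewrite fmorph_eq0.
Qed.
(** * The cone over a convex region *)

Section ConeOver.
Variables (R : realType) (m : nat) (P C : set 'rV[R]_m.+1).
Hypothesis coneC : open_convex_cone C.
Hypothesis PC : cone_over P C.

Lemma cone_over_disjoint x : C x -> ~ C (- x).
Proof. by case: PC => _ nC _ Cx CNx; exact: (nC x). Qed.

Lemma cone_over0 : ~ C 0.
Proof. by move=> C0; apply: (cone_over_disjoint C0); rewrite oppr0. Qed.

Lemma cone_over_neq0 x : C x -> x != 0.
Proof. by move=> Cx; apply/eqP => x0; apply: cone_over0; rewrite -x0. Qed.

Lemma cone_overE x : P x <-> C x \/ C (- x).
Proof. by case: PC => _ _ ->. Qed.

Lemma closure_opp x : closure [set y | C (- y)] x -> closure C (- x).
Proof.
move=> Cx B /oppr_continuous /Cx [y [CNy BNy]].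
by exists (- y); split.
Qed.

Lemma closure_oppV x : closure C (- x) -> closure [set y | C (- y)] x.
Proof.
move=> Cx B; rewrite -{1}(opprK x) => /oppr_continuous /Cx [y [Cy BNy]].
by exists (- y); split; rewrite //= opprK.
Qed.

Lemma real_points_projective (x : 'rV[R]_m.+1) :
  real_points (@projective_space R m.+1) x <-> x != 0.
Proof.
split=> [[]//|x0]; split=> //; apply: contraNneq x0 => x0.
apply/eqP/rowP => j; have := congr1 (fun M : 'rV[R[i]]_m.+1 => M 0 j) x0.
by rewrite !mxE => /complexI.
Qed.

Lemma euclidean_boundary_cone x :
  euclidean_boundary (@projective_space R m.+1) P x <->
  cone_boundary C x \/ cone_boundary C (- x).
Proof.
have [oC _ _] := coneC; have [_ _ PE] := PC.
have oNC : open [set y : 'rV[R]_m.+1 | C (- y)].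
  by apply: open_comp oC => y _; exact: oppr_continuous.
have out (U : set 'rV[R]_m.+1) : open U -> U `<=` P -> U x ->
    ~ closure (real_points (@projective_space R m.+1) `\` P) x.
  move=> oU UP Ux /(_ U (open_nbhs_nbhs (conj oU Ux))) [y [[_ nPy] Uy]].
  exact/nPy/UP.
split.
- move=> [/real_points_projective x0 [clP clN]].
  have nCx : ~ C x.
    by move=> Cx; apply: out oC _ Cx clN; rewrite PE => y; left.
  have nCNx : ~ C (- x).
    by move=> Cx; apply: out oNC _ Cx clN; rewrite PE => y; right.
  move: clP; rewrite PE closureU => -[clC|/closure_opp clC].
    by left; split.
  by right; split; rewrite ?oppr_eq0.
(* [- C] is open and disjoint from [C], so it contains no limit of [C]. *)
- have sym y : cone_boundary C y -> ~ C (- y).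
    move=> [y0 cy _] CNy; have [z [Cz /= CNz]] := cy _ (open_nbhs_nbhs (conj oNC CNy)).
    exact: cone_over_disjoint Cz CNz.
  move=> xB.
  have x0 : x != 0 by case: xB => -[]; rewrite ?oppr_eq0.
  have rx : real_points (@projective_space R m.+1) x by apply/real_points_projective.
  split=> //; split.
    rewrite PE closureU; case: xB => -[_ cx _]; [by left|right].
    exact: closure_oppV.
  apply: subset_closure; split=> // /cone_overE.
  case: xB => [xB|xB]; have := sym _ xB; case: xB => _ _ nC.
    by move=> nCN [].
  by rewrite opprK => nCN [].
Qed.

(** A degenerate case, as when projective space is a point. The line [x + t e] leaves [C], and
    without boundary it can do so only through 0; so [x] is a multiple of [e]. *)
Lemma cone_boundary_empty (e : 'rV[R]_m.+1) x : C e ->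
  (forall y, ~ cone_boundary C y) -> x != 0 -> P x.
Proof.
move=> Ce noB x0; apply/cone_overE.
have [b b0 Cb] := cone_absorb coneC x Ce.
have [a a0 Ca] := cone_absorb coneC (- x) Ce.
have nCa : ~ C (x + (- a) *: e).
  move=> Ca'; apply: cone_over0; have := coneD coneC Ca Ca'.
  by rewrite scaleNr addrA subrK subrr.
have ab : - a <= b by lra.
rewrite addrC in Cb.
have [t [_ Ct nCt]] := cone_boundary_crossing coneC Ce ab Cb nCa.
have [xt|xt] := eqVneq (x + t *: e) 0; last by case: (noB (x + t *: e)); split.
have xE : x = - t *: e by apply/eqP; rewrite scaleNr -addr_eq0 xt.
have t0 : t != 0 by apply: contraNneq x0 => t0; rewrite xE t0 oppr0 scale0r.
case: (ltrP t 0) => ht.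
  by left; rewrite xE; apply: coneZ => //; rewrite oppr_gt0.
right; rewrite xE scaleNr opprK; apply: coneZ => //.
by rewrite lt_neqAle eq_sym t0.
Qed.

Lemma cone_segment_component (A : set 'rV[R]_m.+1) e : C e -> C `<=` A ->
  C `<=` connected_component A e.
Proof.
move=> Ce CA x Cx.
pose f (t : R) : 'rV[R]_m.+1 := e + t *: (x - e).
have cf : continuous f.
  move=> t; rewrite /continuous_at /f.
  by apply: cvgD; [exact: cvg_cst | exact: scalel_continuous].
apply: (@connected_component_max _ _ (f @` `[0, 1])).
- exists 0; first by rewrite /= in_itv /= lexx ler01.
  by rewrite /f scale0r addr0.
- move=> _ [t t01 <-]; apply: CA; rewrite /= in_itv /= in t01.
  have -> : f t = t *: x + (1 - t) *: e.
    by apply/rowP => j; rewrite !mxE; ring.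
  exact: cone_conv.
- apply: connected_continuous_connected; first exact: segment_connected.
  exact: continuous_subspaceT.
- exists 1; first by rewrite /= in_itv /= lexx ler01.
  by rewrite /f scale1r subrKC.
Qed.

Lemma hyperbolicity_region_cone (p : mpoly m.+1 R) (d : nat) e : homog d p -> C e ->
  (forall x, C x -> evalp p x != 0) -> vanishes_on (cone_boundary C) p ->
  P = hyperbolicity_region p e.
Proof.
move=> pd Ce pC pB; have [oC _ _] := coneC.
have CK := cone_segment_component Ce pC.
apply/seteqP; split=> x.
  move=> /cone_overE[Cx|Cx].
    by exists 1, x; split; rewrite ?oner_eq0 ?scale1r ?cone_over_neq0 //; exact: CK.
  exists (-1), (- x); split; rewrite ?oppr_eq0 ?oner_eq0 ?scaleN1r ?opprK //.
    exact: CK.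
  by have := cone_over_neq0 Cx; rewrite oppr_eq0.
move=> [c [y [c0 Ky y0 ->]]].
(* If [p(0) != 0], the homogeneous [p] is a nonzero constant and [C] has no boundary. *)
have [p00|p00] := eqVneq (evalp p 0) 0; last first.
  have pE y' : evalp p y' = evalp p 0.
    have := evalp_homog 0 0 pd; rewrite scale0r => /eqP.
    rewrite eq_sym -subr_eq0 -{2}[evalp p 0]mul1r -mulrBl mulf_eq0 (negPf p00) orbF.
    case: d pd => [|d] pd; last by rewrite expr0n /= sub0r oppr_eq0 oner_eq0.
    move=> _; have := evalp_homog 0 y' pd.
    by rewrite scale0r expr0 mul1r => ->.
  apply: (cone_boundary_empty Ce); last by rewrite scaler_eq0 negb_or c0.
  by move=> y' /pB; rewrite pE => /eqP; rewrite (negPf p00).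
(* [C] is open and closed relative to [p != 0], since [p] vanishes on the boundary and at 0; the
   connected component of [e] therefore lies in [C]. *)
have KE : connected_component [set x | evalp p x != 0] e `&` C =
    connected_component [set x | evalp p x != 0] e.
  apply: (@component_connected _ [set x | evalp p x != 0] e).
  - by exists e; split=> //; exact: CK.
  - by exists C.
  - exists (closure C); first exact: closed_closure.
    apply/seteqP; split=> z [Kz Cz]; split=> //; first exact: subset_closure.
    apply: contrapT => nCz; have /= pz := connected_component_sub Kz.
    have z0 : z != 0 by apply: contraNneq pz => ->; rewrite p00.
    by move/eqP: pz; apply; apply: pB; split.
have Cy : C y by move: Ky; rewrite /hyperbolicity_cone -KE => -[].
apply/cone_overE; have [cneg|cpos] := ltrP c 0.
  by right; rewrite -scaleNr; apply: coneZ => //; rewrite oppr_gt0.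
by left; apply: coneZ => //; rewrite lt_neqAle eq_sym c0.
Qed.

End ConeOver.

(** * Dimension 0 and assembly of the proof *)

Lemma oriented_region_nonempty (R : realType) (n m : nat) (X : set 'rV[R[i]]_n)
    (P : set 'rV[R]_n) (o : orientation R n m) :
  oriented_region X P o -> exists x, P x.
Proof.
move=> [_ [_ _ _ [[Z [Zi _]] _]] _ _ _].
apply: contrapT => /forallNP nP.
have [[[z Zz] _ _] ZP] := Zi 0%N (leq0n m).
have [_ P1] := ZP z Zz.
(* The constant 1 vanishes on the empty set, so the closure of an empty [P] would have no point,
   unlike the first member of a chain of irreducible sets. *)
have h1 : homog 0 (1 : mpoly n R[i]) by exact: dhomog1.
have := P1 0%N 1 h1; rewrite -mpolyC1 evalpC => P2.
by have /eqP := P2 (fun a => fun '(ex_intro2 x Px _) => False_ind _ (nP x Px));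
   rewrite oner_eq0.
Qed.

Lemma canonical_form_oriented (R : realType) (n m : nat) (X : set 'rV[R[i]]_n)
    (P : set 'rV[R]_n) (o : orientation R n m) (w : mform R n m) :
  Defs.canonical_form X P o w -> oriented_region X P o.
Proof. by case: m o w => [|m] o w []. Qed.

(** Projective space is a single point here, so a nonempty [P] has empty complement. *)
Lemma euclidean_boundary_line (R : realType) (P C : set 'rV[R]_1) x :
  open_convex_cone C -> cone_over P C ->
  ~ euclidean_boundary (@projective_space R 1) P x.
Proof.
move=> coneC PC [_ [clP clN]].
have [y [/(cone_overE PC) Py _]] := clP setT filterT.
have [z [[/real_points_projective z0 nPz] _]] := clN setT filterT.
apply: nPz; apply/(cone_overE PC).
have [v Cv [c zE]] : exists2 v, C v & exists c, z = c *: v.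
  have gen (v : 'rV[R]_1) : C v -> exists c, z = c *: v.
    move=> /(cone_over_neq0 PC) v0; exists (z 0 0 / v 0 0).
    have v00 : v 0 0 != 0.
      by apply: contraNneq v0 => v00; apply/eqP/rowP => j; rewrite ord1 mxE.
    by apply/rowP => j; rewrite ord1 mxE divfK.
  by case: Py => Cy; [exists y | exists (- y)] => //; exact: gen.
have c0 : c != 0 by apply: contraNneq z0 => c0; rewrite zE c0 scale0r.
have [cneg|cpos] := ltrP c 0.
  by right; rewrite zE -scaleNr; apply: coneZ => //; rewrite oppr_gt0.
by left; rewrite zE; apply: coneZ => //; rewrite lt_neqAle eq_sym c0.
Qed.

Lemma canonical_boundary (R : realType) (m : nat) (P C : set 'rV[R]_m.+1)
    (o : orientation R m.+1 m) (w : mform R m.+1 m) (q p : mpoly m.+1 R) :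
  open_convex_cone C -> cone_over P C ->
  Defs.canonical_form (@projective_space R m.+1) P o w -> canonical_fraction w q p ->
  forall x, euclidean_boundary (@projective_space R m.+1) P x -> evalp p x = 0.
Proof.
case: m P C o w q p => [|m] P C o w q p coneC PC wP wf x xP.
  by case: (euclidean_boundary_line coneC PC xP).
exact: (canonical_denominator_boundary wP wf xP).
Qed.

Lemma completely_monotone_numerator (R : realType) (m : nat) (C : set 'rV[R]_m.+1)
    (p q : mpoly m.+1 R) : coprimep_mpoly p q ->
  completely_monotone C (fun x => evalp q x / evalp p x) \/
  completely_monotone C (fun x => - (evalp q x / evalp p x)) ->
  exists2 g, coprimep_mpoly p g & completely_monotone C (fun x => evalp g x / evalp p x).
Proof.
move=> pq [cm|cm]; first by exists q.
exists (- q).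
  move=> d a b pE qE; apply: (pq d a (- b) pE).
  by rewrite mulNr -qE opprK.
rewrite (_ : (fun x => _) = (fun x => - (evalp q x / evalp p x))) //.
by apply/funext => x; rewrite evalpN mulNr.
Qed.

Theorem theorem1p1 (R : realType) (m : nat) (P : set 'rV[R]_m.+1)
  (o : orientation R m.+1 m)
  (hP : completely_monotone_geometry P o) :
  exists (p : mpoly m.+1 R) (e : 'rV[R]_m.+1),
    [/\ hyperbolic p e,
        algebraic_boundary (@projective_space R m.+1) P = zero_locus p &
        P = hyperbolicity_region p e].
Proof.
have [_ [w [q [p [C [wP wf PC pC cm]]]]]] := hP.
have [[d [_ pd]] p0 pq _] := wf.
have coneC : open_convex_cone C by case: cm => -[].
have [oC _ _] := coneC.
have [e Ce] : exists e, C e.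
  have [x /(cone_overE PC)] := oriented_region_nonempty (canonical_form_oriented wP).
  by case=> Cx; [exists x | exists (- x)].
have [g pg gm] := completely_monotone_numerator pq cm.
have tube := tube_nonzero coneC pd pC pg (tube_common_zero coneC pC
  (fun l x => @completely_monotone_iter_quo _ _ _ _ _ oC pC l x gm)).
have pB : vanishes_on (cone_boundary C) p.
  move=> x xB; apply: (canonical_boundary coneC PC wP wf).
  by apply/(euclidean_boundary_cone coneC PC); left.
have [s [sp sB sgen]] := vanishing_generator coneC Ce p0 pB.
(* Hyperbolicity asks for a positive value at [e]; a change of sign preserves a generator. *)
have [t [tp tB tgen te]] : exists t, [/\ divides t p,
    vanishes_on (cone_boundary C) t,
    forall h, vanishes_on (cone_boundary C) h -> divides t h & 0 < evalp t e].
  have se : evalp s e != 0.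
    case: sp => c pE; have := pC e Ce; rewrite pE evalpM mulf_eq0 negb_or.
    by case/andP.
  have [s0|s0] := ltrP (evalp s e) 0; last first.
    by exists s; split=> //; rewrite lt_neqAle eq_sym se.
  have dN h : divides s h -> divides (- s) h.
    by move=> [c ->]; exists (- c); rewrite mulrNN.
  exists (- s); split=> [||h hB|]; first exact: dN.
  - by move=> x xB; rewrite evalpN sB ?oppr0.
  - exact/dN/sgen.
  - by rewrite evalpN oppr_gt0.
have [k tk] := divides_dhomog p0 pd tp.
have tC x : C x -> evalp t x != 0.
  move=> Cx; case: tp => c pE; have := pC x Cx; rewrite pE evalpM mulf_eq0 negb_or.
  by case/andP.
exists t, e; split.
- apply: (tube_hyperbolic coneC tk Ce te) => u y Cu; have := tube u y Cu.
  apply: contraNneq => tz; case: tp => c ->.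
  have -> : complexp (c * t) = complexp c * complexp t by exact: rmorphM.
  by apply/eqP; apply: etrans (evalpM _ _ _) _; rewrite [X in _ * X]tz mulr0.
- apply/seteqP; split=> z [z0 zP]; split=> //.
    apply: (zP k); first exact: homog_complexp.
    move=> _ [x xP <-].
    have tx : evalp t x = 0.
      have /(euclidean_boundary_cone coneC PC)[/tB//|/tB] := xP.
      (* The boundary of [P] consists of that of [C] and its opposite; homogeneity of [t] covers the
         latter. *)
      rewrite -scaleN1r (evalp_homog _ _ tk) => /eqP.
      by rewrite mulf_eq0 signr_eq0 => /eqP.
    by apply: etrans (evalp_complexp _ _) _; rewrite tx.
  move=> l h _ hB; apply: (zariski_vanishing tgen) zP => x xB.
  apply: hB; exists x => //.
  by apply/(euclidean_boundary_cone coneC PC); left.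
- exact: (hyperbolicity_region_cone coneC PC tk Ce tC tB).
Qed.
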